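(* Assume that $w,b,c:(0,\epsilon)\to\mathbb{C}$ are optimal trajectories, written in hyperboloid coordinates, tending toward the singular locus $w=b=c=0$ as $t\to0$. Assume that $|w|,|b|,|c|:(0,\epsilon)\to\mathbb{R}$ have finite, non-zero valuations and that the control set $U_r$ has parameters with $\beta/\alpha\neq0$. Then $\mathcal{R}(b,c)$, $\mathcal{R}(c,w)$, $\mathcal{R}(b,w)$, $\mathcal{R}(b,ic)$, $\mathcal{R}(c,iw)$ and $\mathcal{R}(b,iw)$ have valuations, and $$\mathrm{val}|w|=1,\quad \mathrm{val}|b|=2,\quad \mathrm{val}|c|=3,$$ $$\mathrm{val}\,\mathcal{R}(b,w)=3,\quad \mathrm{val}\,\mathcal{R}(c,w)=4,\quad \mathrm{val}\,\mathcal{R}(b,c)=5,$$ $$\mathrm{val}\,\mathcal{R}(b,iw)=3,\quad \mathrm{val}\,\mathcal{R}(c,iw)=4,\quad \mathrm{val}\,\mathcal{R}(b,ic)=5.$$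
   Context: Valuation: $f:(0,\epsilon)\to\mathbb{C}$ has valuation $k\in\mathbb{Z}_{\ge0}$ at $t=0$, written $\mathrm{val}(f)=k$, if $k$ is the smallest integer for which $\lim_{t\to0}f(t)/t^k$ (exists and) is non-zero; if $f\equiv0$ then $\mathrm{val}(f)=+\infty$. Notation: $\mathcal{R}(u,v)=\mathrm{Re}(\bar uv)$, $[p]=\sqrt{1+|p|^2}$ for $p\in\mathbb{C}$. Control set: $U_r=\{u\in\mathbb{R}^3:u_0+u_1+u_2=1,\ u_0^2+u_1^2+u_2^2\le r^2\}$. In $\mathfrak{su}(1,1)$ the controls are the matrices $Z=\begin{pmatrix}-i\alpha&\beta z\\\beta\bar z&i\alpha\end{pmatrix}$, $z\in\mathbb{C}$, $|z|\le1$, with $\alpha=\frac13$, $\beta=\frac23\sqrt{(3r^2-1)/2}$. Put $\beta_1=\beta/\alpha$ and $\mu(w,z)=[w]-\beta_1\mathcal{R}(w,z)$; $\mu(w,z)>0$ is assumed along trajectories (star condition). Hyperboloid coordinates of the state $X$ and costates $\Lambda_1,\Lambda_R$ in $\mathfrak{su}(1,1)$: $$X=\begin{pmatrix}-i[w]&w\\\bar w&i[w]\end{pmatrix},\quad\Lambda_1=\sqrt d\begin{pmatrix}i[b]&b\\\bar b&-i[b]\end{pmatrix},\quad\Lambda_R=\begin{pmatrix}-i\frac{\mathcal{R}(c,w)}{[w]}&c\\\bar c&i\frac{\mathcal{R}(c,w)}{[w]}\end{pmatrix},$$ with $d=\det\Lambda_1>0$ constant. The singular locus is $X=J_{\mathfrak{su}}$,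 $\Lambda_1=-\frac32J_{\mathfrak{su}}$, $\Lambda_R=0$ with $J_{\mathfrak{su}}=\mathrm{diag}(-i,i)$, i.e. $w=b=c=0$ and $d=9/4$. Optimal trajectories are those satisfying the (normal, $\lambda_{cost}=-1$) Pontryagin system $$b'=2i([b]w+b[w]),\qquad w'=i\frac{w-\beta_1[w]z^*}{\mu(w,z^* )},$$ $$c'=i\frac{(-[w]+\beta_1\mathcal{R}(w,z^* ))(-[w]c+\beta_1\mathcal{R}(c,w)z^* )}{[w]\mu(w,z^* )^2}-i\frac{(-\mathcal{R}(c,w)+\beta_1[w]\mathcal{R}(c,z^* ))(-w+\beta_1[w]z^* )}{[w]\mu(w,z^* )^2}-i\left((-3+2[b]\sqrt d)w+2b\sqrt d[w]\right),$$ where $z^*=z^*(t)$, $|z^*|=1$, is the maximizer over $|z|\le1$ of the Hamiltonian $$\mathcal{H}=2\sqrt d\,\mathcal{R}(w,b)+(2\sqrt d[b]-3)[w]-\frac{\mathcal{R}(w-\beta_1z,c)}{\mu(w,z)[w]},$$ and $\mathcal{H}\equiv0$ along the trajectory. The angular momentum $\mathcal{A}=2\sqrt d[b]-2\mathcal{R}(w,c)/[w]$ is constant along such trajectories.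
   Formalization: The last term of the Hamiltonian is taken as R(w − β₁[w]z, c)/(μ(w,z)[w]) instead of the printed R(w − β₁z, c)/(μ(w,z)[w]); with the printed formula, H ≡ 0 contradicts the stated differential equations near t = 0. *)

(* Defs.v *)
From Stdlib Require Import Reals.
From Coquelicot Require Export Coquelicot.
Open Scope R_scope.

(** Curves [(0,eps) -> C] are total functions [R -> C]; only their values on
    [(0,eps)] are ever constrained. *)

Definition tends_to (f : R -> C) (l : C) : Prop :=
  filterlim f (at_right 0) (locally l).

Definition nonzero_limit (f : R -> C) (k : nat) : Prop :=
  exists l : C, l <> RtoC 0 /\ tends_to (fun t => (f t / RtoC (t ^ k))%C) l.

(** [None] stands for the valuation [+oo]. *)
Definition has_val (eps : R) (f : R -> C) (v : option nat) : Prop :=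
  match v with
  | Some k => nonzero_limit f k /\
              forall j : nat, nonzero_limit f j -> (k <= j)%nat
  | None => forall t, 0 < t < eps -> f t = RtoC 0
  end.

Definition has_finite_nonzero_val (eps : R) (f : R -> C) : Prop :=
  exists k : nat, k <> 0%nat /\ has_val eps f (Some k).

Definition Rdot (u v : C) : R := Re (Cconj u * v)%C.

Definition bra (p : C) : R := sqrt (1 + Cmod p ^ 2).

(** The control set
      [{ u in R^3 | u0 + u1 + u2 = 1, u0^2 + u1^2 + u2^2 <= r^2 }]
    corresponds in su(1,1) to the matrices
      [Z = (- i alpha, beta z; beta z^*, i alpha)], [|z| <= 1]. *)
Definition alpha : R := 1 / 3.
Definition beta (r : R) : R := 2 / 3 * sqrt ((3 * r ^ 2 - 1) / 2).
Definition beta1 (r : R) : R := beta r / alpha.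

Definition mu (r : R) (w z : C) : R := bra w - beta1 r * Rdot w z.

(** In terms of [X], [Lambda_1], [Lambda_R], [Z] and [J = diag(-i, i)] this is
      [tr ((Lambda_1 + 3/2 J) X) - tr (Lambda_R Z) / tr (X Z)],
    where [tr (X Z) = - 2 alpha mu] and
      [tr (Lambda_R Z) = - 2 alpha Rdot (w - beta1 [w] z) c / [w]].
    The factor [bra w] in front of [z] is essential: with it the equation for
    [c'] below is the corresponding costate equation and the Hamiltonian is a
    first integral; without it neither holds, and a Hamiltonian vanishing
    along the trajectory would over-determine the system. *)
Definition hamiltonian (r d : R) (w b c z : C) : R :=
  2 * sqrt d * Rdot w b + (2 * sqrt d * bra b - 3) * bra w
  - Rdot (w - RtoC (beta1 r * bra w) * z)%C c / (mu r w z * bra w).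

Definition b_rhs (w b : C) : C :=
  (RtoC 2 * Ci * (RtoC (bra b) * w + b * RtoC (bra w)))%C.

Definition w_rhs (r : R) (w z : C) : C :=
  (Ci * ((w - RtoC (beta1 r * bra w) * z) / RtoC (mu r w z)))%C.

Definition c_rhs (r d : R) (w b c z : C) : C :=
  (Ci * (RtoC (- bra w + beta1 r * Rdot w z)
           * (- (RtoC (bra w) * c) + RtoC (beta1 r * Rdot c w) * z)
         / RtoC (bra w * mu r w z ^ 2))
   - Ci * (RtoC (- Rdot c w + beta1 r * bra w * Rdot c z)
             * (- w + RtoC (beta1 r * bra w) * z)
           / RtoC (bra w * mu r w z ^ 2))
   - Ci * (RtoC (- 3 + 2 * bra b * sqrt d) * w
           + RtoC 2 * b * RtoC (sqrt d) * RtoC (bra w)))%C.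

Definition derivative_is (f : R -> C) (t : R) (l : C) : Prop :=
  is_derive (K := R_AbsRing) (V := C_R_NormedModule) f t l.

Definition star_condition (r : R) (w : C) : Prop :=
  forall z : C, Cmod z <= 1 -> 0 < mu r w z.

Definition is_maximizer (r d : R) (w b c zs : C) : Prop :=
  Cmod zs = 1 /\
  forall z : C, Cmod z <= 1 ->
    hamiltonian r d w b c z <= hamiltonian r d w b c zs.

(** The constant [d] is the determinant of [Lambda_1]. *)
Definition optimal_trajectory (r d eps : R) (w b c : R -> C) : Prop :=
  0 < d /\
  exists zs : R -> C, forall t, 0 < t < eps ->
    star_condition r (w t) /\
    is_maximizer r d (w t) (b t) (c t) (zs t) /\
    hamiltonian r d (w t) (b t) (c t) (zs t) = 0 /\
    derivative_is b t (b_rhs (w t) (b t)) /\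
    derivative_is w t (w_rhs r (w t) (zs t)) /\
    derivative_is c t (c_rhs r d (w t) (b t) (c t) (zs t)).

(** The singular locus is [X = J], [Lambda_1 = - 3/2 J], [Lambda_R = 0]; as [d]
    is constant, reaching it in the limit forces [d = 9/4]. *)
Definition tends_to_singular_locus (d : R) (w b c : R -> C) : Prop :=
  d = 9 / 4 /\ tends_to w (RtoC 0) /\ tends_to b (RtoC 0) /\ tends_to c (RtoC 0).

(* Main.v *)
Require Import Defs.
From Stdlib Require Import Reals Lra Lia.
From Coquelicot Require Import Coquelicot.
Open Scope R_scope.

(** Write [ [p] ] for [bra p], [B = beta1 r > 0] and, on the singular locus,
    [sqrt d = 3/2]. Let [|w| ~ w0 t^k], [|b| ~ b0 t^m], [|c| ~ c0 t^n].

    Near the singular locus [w] is small, the control [z] that maximizes the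
    Hamiltonian points in the direction of [c] up to [O(|w|)]
    ([maximizer_near_direction]), and the Pontryagin system becomes a
    perturbation of Fuller's system
<<
      w' = - i B z,   b' = 2 i w,   c' = - 3 i b,   z = c / |c|,
>>
    on which the vanishing of the Hamiltonian reads [3 R(w,b) + B |c| = 0] up to
    errors of higher order ([reduced_system_of_optimal]). The control need not
    converge: along the logarithmic spirals that solve the unperturbed system it
    turns infinitely often, so the vectors [w], [b], [c] have no leading
    coefficients. Only rotation invariant quantities do, and the proof works
    with those alone, bounding or integrating their derivatives.

    The exponents come from five such facts. First, [b' = O(|w| + |b|)] and
    [c' = O(|b| + |c|)] give [m >= 2] and [n >= 3]. The angular momentum is
    constant up to terms of higher order, so [3 ([b] - 1) [w]], which is of order
    [2m], agrees up to such terms with [2 R(w,c) = O(|w| |c|)], and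
    [k + n <= 2m]. Next, [R(c,iw)' = - 3 R(b,w) + B |c| + ... ~ 2 B |c|] has a
    constant sign, so [R(c,iw)] has order exactly [n + 1]; as it is at most
    [|c| |w|], this forces [k = 1]. Finally [R(b,iw)' = 2 |w|^2 + O(|b|)] would
    make [R(b,iw)] of order 3 if [m >= 3], which [|b| |w|] forbids. Hence
    [m = 2], and [k + n <= 2m] gives [n = 3].

    With the exponents known, the angular momentum, the Hamiltonian and the
    derivatives of [R(c,iw)], [R(b,ic)] and [|c|^2] give the leading
    coefficients of [R(c,w)], [R(b,w)], [R(c,iw)], [R(b,ic)] and the relation
    [c0^2 = 9/10 b0^2]. The products [R(b,c)] and [R(b,iw)] follow from the
    identity [(conj b c) (conj c w) = |c|^2 conj b w] between complex numbers. *)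

(** * Orders of magnitude at the right of zero *)

Notation near0 := (at_right 0).

Definition bigO (f : R -> R) (p : nat) : Prop :=
  exists K, 0 <= K /\ near0 (fun t => Rabs (f t) <= K * t ^ p).

(** With [l = 0] this is [f = o(t^p)], so that [asym f p l] bounds the order of
    vanishing of [f] from below whatever [l] is, and fixes it when [l <> 0]. *)
Definition asym (f : R -> R) (p : nat) (l : R) : Prop :=
  filterlim (fun t => f t / t ^ p) near0 (locally l).

Lemma near0_iff (P : R -> Prop) :
  near0 P <-> exists h, 0 < h /\ forall t, 0 < t < h -> P t.
Proof.
  split.
  - intros [h H]. exists h. split. apply cond_pos.
    intros t Ht. apply H; [|lra].
    change (Rabs (t - 0) < h). rewrite Rminus_0_r, Rabs_pos_eq; lra.
  - intros [h [Hh H]]. exists (mkposreal h Hh). intros t Ht Ht0. apply H.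
    change (Rabs (t - 0) < h) in Ht. rewrite Rminus_0_r in Ht.
    apply Rabs_lt_between in Ht. lra.
Qed.

Lemma near0_lt (h : R) : 0 < h -> near0 (fun t => 0 < t < h).
Proof. intros Hh. apply near0_iff. exists h. auto. Qed.

Lemma near0_const (P : Prop) : near0 (fun _ => P) -> P.
Proof. intros H. apply near0_iff in H as [h [Hh H]]. apply (H (h / 2)). lra. Qed.

Lemma near0_imp (P Q : R -> Prop) :
  near0 P -> (forall t, 0 < t < 1 -> P t -> Q t) -> near0 Q.
Proof.
  intros HP H.
  generalize (filter_and _ _ (near0_lt 1 Rlt_0_1) HP).
  apply filter_imp. intros t [? ?]. auto.
Qed.

Lemma near0_imp2 (P1 P2 Q : R -> Prop) :
  near0 P1 -> near0 P2 -> (forall t, 0 < t < 1 -> P1 t -> P2 t -> Q t) -> near0 Q.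
Proof.
  intros H1 H2 H. apply (near0_imp _ _ (filter_and _ _ H1 H2)).
  intros t Ht [? ?]. auto.
Qed.

Lemma filterlim_near0_iff (f : R -> R) (l : R) :
  filterlim f near0 (locally l) <->
  forall e, 0 < e -> near0 (fun t => Rabs (f t - l) < e).
Proof.
  split.
  - intros H e He. exact (proj1 (filterlim_locally f l) H (mkposreal e He)).
  - intros H. apply filterlim_locally. intros [e He]. exact (H e He).
Qed.

Lemma filterlim_near0_ext (f g : R -> R) (l : R) :
  near0 (fun t => f t = g t) ->
  filterlim f near0 (locally l) -> filterlim g near0 (locally l).
Proof. intros H. apply filterlim_ext_loc. exact H. Qed.

Lemma filterlim_near0_plus (f g : R -> R) (l m : R) :
  filterlim f near0 (locally l) -> filterlim g near0 (locally m) ->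
  filterlim (fun t => f t + g t) near0 (locally (l + m)).
Proof.
  intros Hf Hg.
  exact (filterlim_comp_2 _ _ _ Hf Hg (filterlim_plus (V := R_NormedModule) l m)).
Qed.

Lemma filterlim_near0_mult (f g : R -> R) (l m : R) :
  filterlim f near0 (locally l) -> filterlim g near0 (locally m) ->
  filterlim (fun t => f t * g t) near0 (locally (l * m)).
Proof.
  intros Hf Hg.
  exact (filterlim_comp_2 _ _ _ Hf Hg (filterlim_mult (K := R_AbsRing) l m)).
Qed.

Lemma filterlim_near0_inv (f : R -> R) (l : R) : l <> 0 ->
  filterlim f near0 (locally l) ->
  filterlim (fun t => / f t) near0 (locally (/ l)).
Proof.
  intros Hl Hf. apply (filterlim_comp _ _ _ f Rinv _ _ _ Hf).
  assert (Hc : continuous Rinv l).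
  { apply continuity_pt_filterlim. apply continuity_pt_inv; [|exact Hl].
    apply continuity_pt_id. }
  exact Hc.
Qed.

Lemma filterlim_near0_unique (f : R -> R) (l m : R) :
  filterlim f near0 (locally l) -> filterlim f near0 (locally m) -> l = m.
Proof.
  intros H1 H2. exact (filterlim_locally_unique (V := R_NormedModule) f l m H1 H2).
Qed.

Lemma asym_ext (f g : R -> R) (p : nat) (l : R) :
  near0 (fun t => f t = g t) -> asym f p l -> asym g p l.
Proof.
  intros H. apply filterlim_near0_ext. revert H. apply filter_imp.
  intros t Ht. now rewrite Ht.
Qed.

Lemma asym_unique (f : R -> R) (p : nat) (l m : R) :
  asym f p l -> asym f p m -> l = m.
Proof. apply filterlim_near0_unique. Qed.

Lemma asym_plus (f g : R -> R) (p : nat) (l m : R) :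
  asym f p l -> asym g p m -> asym (fun t => f t + g t) p (l + m).
Proof.
  intros Hf Hg. refine (filterlim_near0_ext _ _ _ _ (filterlim_near0_plus _ _ _ _ Hf Hg)).
  apply filter_forall. intros t. unfold Rdiv. ring.
Qed.

Lemma asym_mult (f g : R -> R) (p q : nat) (l m : R) :
  asym f p l -> asym g q m -> asym (fun t => f t * g t) (p + q) (l * m).
Proof.
  intros Hf Hg. refine (filterlim_near0_ext _ _ _ _ (filterlim_near0_mult _ _ _ _ Hf Hg)).
  apply (near0_imp _ _ (near0_lt 1 Rlt_0_1)). intros t Ht _. rewrite pow_add. field.
  split; apply pow_nonzero; lra.
Qed.

Lemma asym_scal (f : R -> R) (p : nat) (a l : R) :
  asym f p l -> asym (fun t => a * f t) p (a * l).
Proof.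
  intros Hf.
  refine (filterlim_near0_ext _ _ _ _
            (filterlim_near0_mult (fun _ => a) _ a _ (filterlim_const a) Hf)).
  apply filter_forall. intros t. unfold Rdiv. ring.
Qed.

Lemma asym_div (f g : R -> R) (p q : nat) (l m : R) : m <> 0 ->
  asym f (p + q) l -> asym g q m -> asym (fun t => f t / g t) p (l / m).
Proof.
  intros Hm Hf Hg.
  assert (Hnz : near0 (fun t => g t <> 0)).
  { assert (He : 0 < Rabs m) by now apply Rabs_pos_lt.
    apply (near0_imp _ _ (proj1 (filterlim_near0_iff _ _) Hg _ He)).
    intros t Ht H E. rewrite E in H. unfold Rdiv in H.
    rewrite Rmult_0_l, Rminus_0_l, Rabs_Ropp in H. lra. }
  refine (filterlim_near0_ext _ _ _ _
    (filterlim_near0_mult _ _ _ _ Hf (filterlim_near0_inv _ _ Hm Hg))).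
  apply (near0_imp _ _ Hnz). intros t Ht H. rewrite pow_add. field.
  repeat split; try apply pow_nonzero; lra.
Qed.

Lemma bigO_of_asym (f : R -> R) (p : nat) (l : R) : asym f p l -> bigO f p.
Proof.
  intros H. exists (Rabs l + 1). split. { pose proof (Rabs_pos l); lra. }
  apply (near0_imp _ _ (proj1 (filterlim_near0_iff _ _) H 1 Rlt_0_1)).
  intros t Ht H1.
  assert (Hp : 0 < t ^ p) by (apply pow_lt; lra).
  replace (f t) with (f t / t ^ p * t ^ p) by (field; lra).
  rewrite Rabs_mult, (Rabs_pos_eq (t ^ p)) by lra.
  apply Rmult_le_compat_r; [lra|].
  pose proof (Rabs_triang (f t / t ^ p - l) l).
  replace (f t / t ^ p - l + l) with (f t / t ^ p) in H0 by ring. lra.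
Qed.

Lemma asym_0_of_bigO (f : R -> R) (p q : nat) : (q < p)%nat ->
  bigO f p -> asym f q 0.
Proof.
  intros Hpq [K [HK H]]. apply filterlim_near0_iff. intros e He.
  assert (Hd : 0 < e / (K + 1)) by (apply Rdiv_lt_0_compat; lra).
  apply (near0_imp2 _ _ _ H (near0_lt _ Hd)). intros t Ht H1 [_ H2].
  assert (Hq : 0 < t ^ q) by (apply pow_lt; lra).
  rewrite Rminus_0_r. unfold Rdiv. rewrite Rabs_mult, Rabs_inv, (Rabs_pos_eq (t ^ q)) by lra.
  apply (Rmult_lt_reg_r (t ^ q)); [lra|].
  replace (Rabs (f t) * / t ^ q * t ^ q) with (Rabs (f t)) by (field; lra).
  apply Rle_lt_trans with (1 := H1).
  replace p with (S (p - S q) + q)%nat by lia. rewrite pow_add, <- Rmult_assoc.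
  apply Rmult_lt_compat_r; [lra|]. simpl.
  assert (t ^ (p - S q) <= 1).
  { rewrite <- (pow1 (p - S q)). apply pow_incr. lra. }
  assert (0 < t ^ (p - S q)) by (apply pow_lt; lra).
  assert (t * (K + 1) < e).
  { apply (Rmult_lt_compat_r (K + 1)) in H2; [|lra].
    replace (e / (K + 1) * (K + 1)) with e in H2 by (field; lra). lra. }
  nra.
Qed.

Lemma bigO_weaken (f : R -> R) (p q : nat) : (q <= p)%nat -> bigO f p -> bigO f q.
Proof.
  intros Hpq [K [HK H]]. exists K. split; [exact HK|].
  apply (near0_imp _ _ H). intros t Ht H1. apply Rle_trans with (1 := H1).
  apply Rmult_le_compat_l; [lra|]. replace p with (q + (p - q))%nat by lia.
  rewrite pow_add.
  assert (t ^ (p - q) <= 1).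
  { rewrite <- (pow1 (p - q)). apply pow_incr. lra. }
  assert (0 < t ^ q) by (apply pow_lt; lra). nra.
Qed.

Lemma bigO_le (f g : R -> R) (p : nat) (K : R) : 0 <= K ->
  near0 (fun t => Rabs (f t) <= K * Rabs (g t)) -> bigO g p -> bigO f p.
Proof.
  intros HK H [L [HL HO]]. exists (K * L). split. { now apply Rmult_le_pos. }
  apply (near0_imp2 _ _ _ H HO). intros t Ht H1 H2. nra.
Qed.

Lemma bigO_plus (f g : R -> R) (p : nat) :
  bigO f p -> bigO g p -> bigO (fun t => f t + g t) p.
Proof.
  intros [K [HK Hf]] [L [HL Hg]]. exists (K + L). split; [lra|].
  apply (near0_imp2 _ _ _ Hf Hg). intros t Ht H1 H2.
  pose proof (Rabs_triang (f t) (g t)). lra.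
Qed.

Lemma bigO_mult (f g : R -> R) (p q : nat) :
  bigO f p -> bigO g q -> bigO (fun t => f t * g t) (p + q).
Proof.
  intros [K [HK Hf]] [L [HL Hg]]. exists (K * L). split; [now apply Rmult_le_pos|].
  apply (near0_imp2 _ _ _ Hf Hg). intros t Ht H1 H2.
  rewrite Rabs_mult, pow_add.
  replace (K * L * (t ^ p * t ^ q)) with ((K * t ^ p) * (L * t ^ q)) by ring.
  apply Rmult_le_compat; auto using Rabs_pos.
Qed.

Lemma bigO_scal (f : R -> R) (p : nat) (a : R) :
  bigO f p -> bigO (fun t => a * f t) p.
Proof.
  apply (bigO_le _ f p (Rabs a)). apply Rabs_pos. apply filter_forall.
  intros t. rewrite Rabs_mult. lra.
Qed.

Lemma bigO_const (a : R) : bigO (fun _ => a) 0.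
Proof.
  exists (Rabs a). split. apply Rabs_pos. apply filter_forall. intros t. simpl. lra.
Qed.

(** How every leading term below is found: an explicit main term plus an error
    one order smaller. *)
Lemma asym_perturb (f g : R -> R) (p : nat) (l : R) :
  asym f p l -> bigO (fun t => g t - f t) (S p) -> asym g p l.
Proof.
  intros Hf Ho. rewrite <- (Rplus_0_r l).
  refine (asym_ext _ _ _ _ _ (asym_plus _ _ _ _ _ Hf (asym_0_of_bigO _ _ p _ Ho))); [|lia].
  apply filter_forall. intros t. ring.
Qed.

(** [f - M / (p + 1) t^(p + 1)] is nonincreasing and tends to [0] at [0], hence
    is nonpositive. The mean value theorem, unlike integration, allows any
    derivative [g], such as a formula involving a discontinuous control. *)
Lemma le_pow_of_derive_le (f g : R -> R) (p : nat) (M : R) :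
  near0 (fun t => is_derive f t (g t)) ->
  filterlim f near0 (locally 0) ->
  near0 (fun t => g t <= M * t ^ p) ->
  near0 (fun t => f t <= M / INR (S p) * t ^ S p).
Proof.
  intros Hd H0 Hg.
  pose proof (filter_and _ _ Hd Hg) as H. apply near0_iff in H as [h [Hh H]].
  apply near0_iff. exists h. split; [exact Hh|]. intros t Ht.
  assert (HS : INR (S p) <> 0) by (apply not_0_INR; lia).
  set (F s := f s - M / INR (S p) * s ^ S p).
  assert (HF : forall s, 0 < s < h -> is_derive F s (g s - M * s ^ p)).
  { intros s Hs. unfold F. apply (is_derive_minus (V := R_NormedModule)).
    - apply H; lra.
    - evar_last. apply is_derive_scal. apply is_derive_pow. apply is_derive_id.
      simpl pred. unfold one; simpl. field. exact HS. }
  assert (HF0 : filterlim F near0 (locally 0)).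
  { replace (locally 0) with (locally (0 + (- (M / INR (S p))) * 0)) by (f_equal; ring).
    apply (filterlim_near0_ext (fun s => f s + (- (M / INR (S p))) * s ^ S p)).
    { apply filter_forall. intros s. unfold F. ring. }
    apply filterlim_near0_plus; [exact H0|].
    apply filterlim_near0_mult. apply filterlim_const.
    replace (locally 0) with (locally (0 ^ S p)) by (f_equal; simpl; ring).
    assert (Hc : continuous (fun s : R => s ^ S p) 0).
    { apply (ex_derive_continuous (V := R_NormedModule)).
      eexists. apply is_derive_pow. apply is_derive_id. }
    intros P HP. apply filter_le_within. exact (Hc P HP). }
  assert (Hmono : forall s, 0 < s <= t -> F t <= F s).
  { intros s Hs. destruct (Req_dec s t) as [->|Hne]; [lra|].
    destruct (MVT_gen F s t (fun s => g s - M * s ^ p)) as [x [Hx HE]].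
    - intros x. rewrite Rmin_left, Rmax_right by lra. intros Hx. apply HF. lra.
    - intros x. rewrite Rmin_left, Rmax_right by lra. intros Hx.
      apply continuity_pt_filterlim. apply (ex_derive_continuous (V := R_NormedModule)).
      eexists. apply HF. lra.
    - rewrite Rmin_left, Rmax_right in Hx by lra.
      destruct (H x) as [_ Hgx]; [lra|]. simpl in HE. nra. }
  enough (F t <= 0) by (unfold F in *; lra).
  apply Rnot_lt_le. intros Hpos.
  assert (Hc := proj1 (filterlim_near0_iff _ _) HF0 _ Hpos).
  apply near0_const. apply (near0_imp2 _ _ _ Hc (near0_lt t (proj1 Ht))).
  intros s _ H1 H2. specialize (Hmono s). rewrite Rminus_0_r in H1.
  apply Rabs_lt_between in H1. lra.
Qed.

Lemma ge_pow_of_derive_ge (f g : R -> R) (p : nat) (M : R) :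
  near0 (fun t => is_derive f t (g t)) ->
  filterlim f near0 (locally 0) ->
  near0 (fun t => M * t ^ p <= g t) ->
  near0 (fun t => M / INR (S p) * t ^ S p <= f t).
Proof.
  intros Hd H0 Hg.
  assert (H : near0 (fun t => - f t <= (- M) / INR (S p) * t ^ S p)).
  { apply le_pow_of_derive_le with (g := fun t => - g t).
    - revert Hd. apply filter_imp. intros t. apply (is_derive_opp (V := R_NormedModule)).
    - replace (locally 0) with (locally (-1 * 0)) by (f_equal; ring).
      apply (filterlim_near0_ext (fun t => -1 * f t)).
      { apply filter_forall. intros; ring. }
      apply filterlim_near0_mult; [apply filterlim_const|exact H0].
    - revert Hg. apply filter_imp. intros t. lra. }
  revert H. apply filter_imp. intros t H. unfold Rdiv in *. lra.
Qed.

Lemma bigO_of_derive (f g : R -> R) (p : nat) :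
  near0 (fun t => is_derive f t (g t)) ->
  filterlim f near0 (locally 0) -> bigO g p -> bigO f (S p).
Proof.
  intros Hd H0 [K [HK Hg]].
  assert (HS : 0 < INR (S p)) by (apply lt_0_INR; lia).
  exists (K / INR (S p)). split. { apply Rdiv_le_0_compat; lra. }
  assert (H1 := le_pow_of_derive_le f g p K Hd H0).
  assert (H2 := ge_pow_of_derive_ge f g p (- K) Hd H0).
  apply (near0_imp2 _ _ _
    (H1 (near0_imp _ _ Hg (fun t _ H => proj2 (proj1 (Rabs_le_between _ _) H))))
    (H2 (near0_imp _ _ Hg (fun t _ H => Rle_trans _ _ _
      (Req_le _ _ (Ropp_mult_distr_l_reverse _ _)) (proj1 (proj1 (Rabs_le_between _ _) H)))))).
  intros t _ Hl Hu. apply Rabs_le_between. unfold Rdiv in *. lra.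
Qed.

Lemma asym_of_derive (f g : R -> R) (p : nat) (l : R) :
  near0 (fun t => is_derive f t (g t)) ->
  filterlim f near0 (locally 0) -> asym g p l -> asym f (S p) (l / INR (S p)).
Proof.
  intros Hd H0 Hg. apply filterlim_near0_iff. intros e He.
  assert (HS : 1 <= INR (S p)) by (rewrite S_INR; pose proof (pos_INR p); lra).
  assert (He2 : 0 < e / 2) by lra.
  assert (Hb := proj1 (filterlim_near0_iff _ _) Hg _ He2).
  assert (H1 : near0 (fun t => g t <= (l + e / 2) * t ^ p)).
  { apply (near0_imp _ _ Hb). intros t Ht H.
    assert (Hp : 0 < t ^ p) by (apply pow_lt; lra).
    apply Rabs_lt_between in H. apply Rlt_le, (proj1 (Rlt_div_l _ _ _ Hp)). lra. }
  assert (H2 : near0 (fun t => (l - e / 2) * t ^ p <= g t)).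
  { apply (near0_imp _ _ Hb). intros t Ht H.
    assert (Hp : 0 < t ^ p) by (apply pow_lt; lra).
    apply Rabs_lt_between in H. apply Rlt_le, (proj2 (Rlt_div_r _ _ _ Hp)). lra. }
  apply (near0_imp2 _ _ _ (le_pow_of_derive_le f g p _ Hd H0 H1)
                          (ge_pow_of_derive_ge f g p _ Hd H0 H2)).
  intros t Ht Hu Hl.
  assert (Hp : 0 < t ^ S p) by (apply pow_lt; lra).
  assert (Hu' : f t / t ^ S p <= (l + e / 2) / INR (S p)).
  { apply (proj2 (Rle_div_l _ _ _ Hp)). lra. }
  assert (Hl' : (l - e / 2) / INR (S p) <= f t / t ^ S p).
  { apply (proj1 (Rle_div_r _ _ _ Hp)). lra. }
  assert (Hi : 0 < / INR (S p) <= 1).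
  { split. apply Rinv_0_lt_compat; lra. rewrite <- Rinv_1. apply Rinv_le_contravar; lra. }
  apply Rabs_lt_between. unfold Rdiv in *. nra.
Qed.

Lemma bigO_ext (f g : R -> R) (p : nat) :
  near0 (fun t => f t = g t) -> bigO f p -> bigO g p.
Proof.
  intros H. apply (bigO_le g f p 1); [lra|]. revert H. apply filter_imp.
  intros t ->. lra.
Qed.

Lemma bigO_opp (f : R -> R) (p : nat) : bigO f p -> bigO (fun t => - f t) p.
Proof.
  apply (bigO_le _ f p 1); [lra|]. apply filter_forall. intros t. rewrite Rabs_Ropp. lra.
Qed.

Lemma bigO_minus (f g : R -> R) (p : nat) :
  bigO f p -> bigO g p -> bigO (fun t => f t - g t) p.
Proof. intros Hf Hg. exact (bigO_plus _ _ _ Hf (bigO_opp _ _ Hg)). Qed.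

(** All restrictions on the exponents are obtained by confronting a leading term
    with a bound in this way. *)
Lemma bigO_order_le (f : R -> R) (m p : nat) (l : R) :
  l <> 0 -> asym f m l -> bigO f p -> (p <= m)%nat.
Proof.
  intros Hl Ha Ho. destruct (Nat.le_gt_cases p m) as [H|H]; [exact H|].
  destruct Hl. exact (asym_unique _ _ _ _ Ha (asym_0_of_bigO _ _ _ H Ho)).
Qed.

Lemma asym_const (a : R) : asym (fun _ => a) 0 a.
Proof.
  apply (filterlim_near0_ext (fun _ => a)); [|apply filterlim_const].
  apply filter_forall. intros t. simpl. field.
Qed.

Lemma bigO_filterlim (f : R -> R) (p : nat) : (0 < p)%nat -> bigO f p ->
  filterlim f near0 (locally 0).
Proof.
  intros Hp Ho. refine (filterlim_near0_ext _ _ _ _ (asym_0_of_bigO f p 0 Hp Ho)).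
  apply filter_forall. intros t. simpl. field.
Qed.

Lemma near0_pos_of_asym (f : R -> R) (p : nat) (l : R) :
  (forall t, 0 <= f t) -> 0 < l -> asym f p l -> near0 (fun t => 0 < f t).
Proof.
  intros Hf Hl H. apply (near0_imp _ _ (proj1 (filterlim_near0_iff _ _) H l Hl)).
  intros t Ht H1. destruct (Hf t) as [|H0]; [assumption|].
  rewrite <- H0 in H1. unfold Rdiv in H1.
  rewrite Rmult_0_l, Rminus_0_l, Rabs_Ropp, Rabs_pos_eq in H1; lra.
Qed.

(** * The optimal control near the singular locus *)

Lemma Rdot_coord (u v : C) : Rdot u v = fst u * fst v + snd u * snd v.
Proof. unfold Rdot. simpl. ring. Qed.

(** Identities between inner products in the plane hold coordinatewise. *)
Ltac Rdot_ring := rewrite ?Rdot_coord; simpl; ring.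

Lemma Rdot_sym (u v : C) : Rdot u v = Rdot v u.
Proof. Rdot_ring. Qed.

Lemma Rdot_Ci_antisym (u v : C) : Rdot u (Ci * v)%C = - Rdot v (Ci * u)%C.
Proof. Rdot_ring. Qed.

Lemma Rdot_self (u : C) : Rdot u u = Cmod u ^ 2.
Proof. rewrite Rdot_coord, Cmod2_alt. unfold Re, Im. ring. Qed.

Lemma Rdot_le_Cmod (u v : C) : Rabs (Rdot u v) <= Cmod u * Cmod v.
Proof.
  unfold Rdot. eapply Rle_trans; [apply re_le_Cmod|].
  rewrite Cmod_mult, Cmod_conj. apply Rle_refl.
Qed.

Lemma bra_sqr (p : C) : bra p ^ 2 = 1 + Cmod p ^ 2.
Proof. unfold bra. apply pow2_sqrt. nra. Qed.

Lemma bra_ge_1 (p : C) : 1 <= bra p.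
Proof.
  unfold bra. rewrite <- sqrt_1 at 1. apply sqrt_le_1_alt. nra.
Qed.

Lemma Cmod_le_bra (p : C) : Cmod p <= bra p.
Proof.
  pose proof (bra_sqr p). pose proof (bra_ge_1 p). pose proof (Cmod_ge_0 p). nra.
Qed.

Lemma bra_le (p : C) : bra p - 1 <= Cmod p ^ 2 / 2.
Proof. pose proof (bra_sqr p). pose proof (bra_ge_1 p). nra. Qed.

Lemma Cmod_RtoC_pos (x : R) : 0 <= x -> Cmod (RtoC x) = x.
Proof. intros. rewrite Cmod_R. now apply Rabs_pos_eq. Qed.

Lemma Cmod_triangle_minus (x y : C) : Cmod (x - y) <= Cmod x + Cmod y.
Proof. unfold Cminus. rewrite <- (Cmod_opp y). apply Cmod_triangle. Qed.

Lemma Cdiv_RtoC (x : C) (m : R) : m <> 0 -> (x / RtoC m = RtoC (/ m) * x)%C.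
Proof. intros. rewrite RtoC_inv by assumption. unfold Cdiv. apply Cmult_comm. Qed.

Section Pointwise.
Variables (r : R) (w b c z : C).
Let B := beta1 r.
Hypothesis HB : 0 < B.
Hypothesis Hw1 : Cmod w <= 1.
Hypothesis HwB : B * Cmod w <= 1 / 2.

Lemma mu_ge_half (v : C) : Cmod v <= 1 -> 1 / 2 <= mu r w v.
Proof.
  intros Hv. unfold mu. fold B. pose proof (bra_ge_1 w).
  pose proof (Rdot_le_Cmod w v) as H1. apply Rabs_le_between in H1.
  pose proof (Cmod_ge_0 w). pose proof (Cmod_ge_0 v).
  assert (Rdot w v <= Cmod w) by nra. nra.
Qed.

Lemma mu_minus_1_le (v : C) : Cmod v <= 1 ->
  Rabs (mu r w v - 1) <= (1 + B) * Cmod w.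
Proof.
  intros Hv. unfold mu. fold B. pose proof (bra_ge_1 w). pose proof (bra_le w).
  pose proof (Rdot_le_Cmod w v) as H1. apply Rabs_le_between in H1.
  pose proof (Cmod_ge_0 w). pose proof (Cmod_ge_0 v).
  assert (- Cmod w <= Rdot w v <= Cmod w) by nra. apply Rabs_le_between. nra.
Qed.

Hypothesis Hz : Cmod z = 1.

(** In [w' = i (w - B [w] z) / mu], the difference [mu - [w] = - B R(w,z)] is
    already [O(|w|)], which leaves [w' + i B z = i (w - B^2 R(w,z) z) / mu]. *)
Lemma w_rhs_approx :
  Cmod (w_rhs r w z + Ci * (RtoC B * z)) <= 10 * (1 + B) ^ 2 * Cmod w.
Proof.
  assert (Hmu := mu_ge_half z (Req_le _ _ Hz)).
  replace (w_rhs r w z + Ci * (RtoC B * z))%C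
    with (Ci * (RtoC (/ mu r w z) * (w - RtoC (B ^ 2 * Rdot w z) * z)))%C.
  - rewrite !Cmod_mult, Cmod_Ci, Cmod_RtoC_pos by (apply Rlt_le, Rinv_0_lt_compat; lra).
    assert (H1 := Cmod_triangle_minus w (RtoC (B ^ 2 * Rdot w z) * z)).
    rewrite Cmod_mult, Hz, Cmod_R, Rabs_mult, (Rabs_pos_eq (B ^ 2)) in H1 by nra.
    assert (H2 := Rdot_le_Cmod w z). rewrite Hz in H2.
    assert (H3 : / mu r w z <= 2).
    { replace 2 with (/ (1 / 2)) by lra. apply Rinv_le_contravar; lra. }
    assert (0 < / mu r w z) by (apply Rinv_0_lt_compat; lra).
    assert (H4 : Cmod (w - RtoC (B ^ 2 * Rdot w z) * z) <= (1 + B ^ 2) * Cmod w).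
    { assert (B ^ 2 * Rabs (Rdot w z) <= B ^ 2 * Cmod w) by nra. lra. }
    pose proof (Cmod_ge_0 w). pose proof (Cmod_ge_0 (w - RtoC (B ^ 2 * Rdot w z) * z)).
    apply Rle_trans with (2 * ((1 + B ^ 2) * Cmod w)). nra.
    assert (0 <= (10 * (1 + B) ^ 2 - 2 * (1 + B ^ 2)) * Cmod w) by (apply Rmult_le_pos; nra).
    lra.
  - unfold w_rhs. fold B. rewrite Cdiv_RtoC by lra. rewrite Rdot_coord.
    assert (E : mu r w z = bra w - B * (fst w * fst z + snd w * snd z)).
    { unfold mu. fold B. now rewrite Rdot_coord. }
    rewrite E in *. apply injective_projections; simpl; field; lra.
Qed.

(** The costate equation is its terms linear in [c] plus the terms in [w] and
    [b]; only the size of the former matters, because [R(w,c')] and the other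
    products to be integrated multiply them by a small factor. *)
Lemma c_rhs_approx :
  Cmod (c_rhs r (9 / 4) w b c z
        + RtoC 3 * (Ci * (RtoC (bra b - 1) * w + RtoC (bra w) * b)))
  <= 10 * (1 + B) ^ 2 * Cmod c.
Proof.
  assert (Hmu := mu_ge_half z (Req_le _ _ Hz)).
  assert (Hs : sqrt (9 / 4) = 3 / 2).
  { replace (9 / 4) with ((3 / 2) ^ 2) by lra. apply sqrt_pow2. lra. }
  pose proof (bra_ge_1 w) as Hbr. pose proof (Cmod_le_bra w) as Hwb.
  set (X1 := (RtoC (bra w) * c - RtoC (B * Rdot c w) * z)%C).
  set (X2 := (RtoC (- Rdot c w + B * bra w * Rdot c z) * (RtoC (B * bra w) * z - w))%C).
  replace (c_rhs r (9 / 4) w b c z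
        + RtoC 3 * (Ci * (RtoC (bra b - 1) * w + RtoC (bra w) * b)))%C
   with (Ci * (RtoC (/ (bra w * mu r w z)) * X1)
         - Ci * (RtoC (/ (bra w * mu r w z ^ 2)) * X2))%C.
  - eapply Rle_trans; [apply Cmod_triangle_minus|].
    assert (P1 : 0 < bra w * mu r w z) by nra.
    assert (P2 : 0 < bra w * mu r w z ^ 2) by nra.
    rewrite !Cmod_mult, Cmod_Ci, !Cmod_RtoC_pos
      by (apply Rlt_le, Rinv_0_lt_compat; assumption).
    pose proof (Cmod_ge_0 c) as Hc. pose proof (Cmod_ge_0 w) as Hw.
    assert (D1 := Rdot_le_Cmod c w). assert (D2 := Rdot_le_Cmod c z).
    rewrite Hz, Rmult_1_r in D2.
    assert (D1' : Rabs (Rdot c w) <= Cmod c * bra w) by nra.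
    assert (Q1 : Cmod X1 <= (1 + B) * (bra w * Cmod c)).
    { unfold X1. eapply Rle_trans; [apply Cmod_triangle_minus|].
      rewrite !Cmod_mult, Hz, Cmod_RtoC_pos, Cmod_R, Rabs_mult, (Rabs_pos_eq B) by lra.
      nra. }
    assert (Q2 : Cmod X2 <= ((1 + B) * (bra w * Cmod c)) * ((1 + B) * bra w)).
    { unfold X2. rewrite Cmod_mult.
      apply Rmult_le_compat; try apply Cmod_ge_0.
      - rewrite Cmod_R. eapply Rle_trans; [apply Rabs_triang|].
        rewrite Rabs_Ropp, Rabs_mult, (Rabs_pos_eq (B * bra w)) by nra.
        assert (B * bra w * Rabs (Rdot c z) <= B * bra w * Cmod c).
        { apply Rmult_le_compat_l; nra. }
        nra.
      - eapply Rle_trans; [apply Cmod_triangle_minus|].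
        rewrite Cmod_mult, Hz, Cmod_RtoC_pos by nra. nra. }
    assert (Hi : 0 < / mu r w z <= 2).
    { split. apply Rinv_0_lt_compat; lra.
      replace 2 with (/ (1 / 2)) by lra. apply Rinv_le_contravar; lra. }
    assert (S1 : / (bra w * mu r w z) * Cmod X1 <= 2 * (1 + B) * Cmod c).
    { apply Rle_trans with (/ (bra w * mu r w z) * ((1 + B) * (bra w * Cmod c))).
      - apply Rmult_le_compat_l; [|exact Q1]. apply Rlt_le, Rinv_0_lt_compat, P1.
      - replace (/ (bra w * mu r w z) * ((1 + B) * (bra w * Cmod c)))
          with (/ mu r w z * ((1 + B) * Cmod c)) by (field; lra).
        assert (0 <= (1 + B) * Cmod c) by (apply Rmult_le_pos; lra). nra. }
    assert (S2 : / (bra w * mu r w z ^ 2) * Cmod X2 <= 8 * (1 + B) ^ 2 * Cmod c).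
    { apply Rle_trans with
        (/ (bra w * mu r w z ^ 2) * (((1 + B) * (bra w * Cmod c)) * ((1 + B) * bra w))).
      - apply Rmult_le_compat_l; [|exact Q2]. apply Rlt_le, Rinv_0_lt_compat, P2.
      - replace (/ (bra w * mu r w z ^ 2) * (((1 + B) * (bra w * Cmod c)) * ((1 + B) * bra w)))
          with ((/ mu r w z * / mu r w z * bra w) * ((1 + B) ^ 2 * Cmod c)) by (field; lra).
        replace (8 * (1 + B) ^ 2 * Cmod c) with (8 * ((1 + B) ^ 2 * Cmod c)) by ring.
        apply Rmult_le_compat_r. { apply Rmult_le_pos; nra. }
        assert (bra w <= 2) by (pose proof (bra_le w); nra).
        assert (/ mu r w z * / mu r w z <= 4) by nra. nra. }
    assert (0 <= ((1 + B) ^ 2 - (1 + B)) * Cmod c) by (apply Rmult_le_pos; nra).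
    lra.
  - unfold c_rhs, X1, X2. fold B.
    assert (P : bra w * mu r w z ^ 2 <> 0).
    { apply Rgt_not_eq, Rmult_lt_0_compat; [lra|apply pow_lt; lra]. }
    rewrite Hs, !(Cdiv_RtoC _ _ P).
    assert (E : - bra w + B * Rdot w z = - mu r w z) by (unfold mu; fold B; ring).
    rewrite E.
    apply injective_projections; simpl; field; lra.
Qed.

Hypothesis Hc : 0 < Cmod c.
Hypothesis Hmax : is_maximizer r (9 / 4) w b c z.

(** Comparing the values of the Hamiltonian at [z] and [e = c / |c|] would only
    give [|z - e|^2 = O(|w|)]. Clearing the denominators [mu] first makes the
    difference of the two sides linear in [z - e]: with [D = z - e] one gets
    [[w] |c| |D|^2 / 2 * mu e <= N e * R(w,D)], whose right-hand side is
    [O(|c| |w| |D|)], and a factor [|D|] cancels. *)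
Lemma maximizer_near_direction :
  Cmod (RtoC (Cmod c) * z - c) <= 4 * (1 + B) * Cmod w * Cmod c.
Proof.
  set (e := (RtoC (/ Cmod c) * c)%C).
  assert (He : Cmod e = 1).
  { unfold e. rewrite Cmod_mult, Cmod_RtoC_pos. field; lra.
    apply Rlt_le, Rinv_0_lt_compat, Hc. }
  destruct Hmax as [_ Hm]. specialize (Hm e (Req_le _ _ He)).
  assert (Mz := mu_ge_half z (Req_le _ _ Hz)).
  assert (Me := mu_ge_half e (Req_le _ _ He)).
  pose proof (bra_ge_1 w) as Hbr. pose proof (Cmod_le_bra w) as Hwb.
  pose proof (Cmod_ge_0 w) as Hw.
  set (N v := B * bra w * Rdot v c - Rdot w c).
  assert (HN : N e * mu r w z <= N z * mu r w e).
  { unfold hamiltonian in Hm. fold B in Hm.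
    replace (Rdot (w - RtoC (B * bra w) * e) c) with (- N e) in Hm
      by (unfold N; Rdot_ring).
    replace (Rdot (w - RtoC (B * bra w) * z) c) with (- N z) in Hm
      by (unfold N; Rdot_ring).
    assert (H : N e / (mu r w e * bra w) <= N z / (mu r w z * bra w)).
    { unfold Rdiv in *. lra. }
    apply (Rmult_le_compat_r (mu r w e * bra w * mu r w z)) in H;
      [|repeat apply Rmult_le_pos; lra].
    replace (N e / (mu r w e * bra w) * (mu r w e * bra w * mu r w z))
      with (N e * mu r w z) in H by (field; lra).
    replace (N z / (mu r w z * bra w) * (mu r w e * bra w * mu r w z))
      with (N z * mu r w e) in H by (field; lra).
    exact H. }
  set (D := (z - e)%C).
  assert (Ec : c = (RtoC (Cmod c) * e)%C).
  { unfold e. rewrite Cmult_assoc, <- RtoC_mult, Rinv_r by lra. ring. }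
  clearbody e.
  assert (Eec : Rdot e c = Cmod c).
  { transitivity (Cmod c * Rdot e e).
    - rewrite Ec at 1. Rdot_ring.
    - rewrite Rdot_self, He. ring. }
  assert (Ezc : Rdot z c = Cmod c - Cmod c * (Cmod D ^ 2 / 2)).
  { rewrite Ec at 1.
    transitivity (Cmod c * (Rdot z z + Rdot e e) / 2 - Cmod c * (Rdot D D / 2)).
    - unfold D. rewrite !Rdot_coord. simpl. field.
    - rewrite !Rdot_self, He, Hz. field. }
  assert (Emu : mu r w z = mu r w e - B * Rdot w D).
  { unfold mu. fold B. unfold D. Rdot_ring. }
  assert (Hkey : bra w * Cmod c * (Cmod D ^ 2 / 2) * mu r w e <= N e * Rdot w D).
  { assert (N z = N e - B * (bra w * Cmod c * (Cmod D ^ 2 / 2))).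
    { unfold N. rewrite Ezc, Eec. ring. }
    rewrite H, Emu in HN.
    apply (Rmult_le_reg_l B); [exact HB|]. lra. }
  assert (HNe : Rabs (N e) <= (1 + B) * (bra w * Cmod c)).
  { unfold N. rewrite Eec. eapply Rle_trans; [apply Rabs_triang|].
    rewrite Rabs_Ropp, (Rabs_pos_eq (B * bra w * Cmod c)).
    - pose proof (Rdot_le_Cmod w c). nra.
    - apply Rmult_le_pos; nra. }
  assert (HD : Cmod D <= 4 * (1 + B) * Cmod w).
  { pose proof (Cmod_ge_0 D) as HD0.
    destruct (Req_dec (Cmod D) 0) as [->|HDne]. { apply Rmult_le_pos; nra. }
    assert (HNR : N e * Rdot w D <= (1 + B) * (bra w * Cmod c) * (Cmod w * Cmod D)).
    { eapply Rle_trans; [apply Rle_abs|]. rewrite Rabs_mult.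
      apply Rmult_le_compat; auto using Rabs_pos, Rdot_le_Cmod. }
    assert (Hq : 0 < bra w * Cmod c) by nra.
    assert (Cmod D ^ 2 / 2 * mu r w e <= (1 + B) * (Cmod w * Cmod D)).
    { apply (Rmult_le_reg_l (bra w * Cmod c)); [exact Hq|]. lra. }
    apply (Rmult_le_reg_r (Cmod D)); [lra|].
    assert (Cmod D ^ 2 / 2 * (1 / 2) <= Cmod D ^ 2 / 2 * mu r w e) by nra.
    lra. }
  replace (RtoC (Cmod c) * z - c)%C with (RtoC (Cmod c) * D)%C.
  - rewrite Cmod_mult, Cmod_RtoC_pos by lra. nra.
  - rewrite Ec at 3. unfold D. ring.
Qed.

(** The leading term of [H] in the direction [z ~ c / |c|]: the last fraction of
    the Hamiltonian is [- B |c|] up to [O(|w| |c|)], and [[b] - 1 = O(|b|^2)]. *)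
Lemma hamiltonian_zero_approx : hamiltonian r (9 / 4) w b c z = 0 ->
  Rabs (3 * Rdot w b + B * Cmod c)
  <= 10 * (1 + B) ^ 2 * (Cmod w * Cmod c + Cmod b ^ 2).
Proof.
  intros H0. unfold hamiltonian in H0. fold B in H0.
  assert (Hs : sqrt (9 / 4) = 3 / 2).
  { replace (9 / 4) with ((3 / 2) ^ 2) by lra. apply sqrt_pow2. lra. }
  rewrite Hs in H0.
  assert (Mz := mu_ge_half z (Req_le _ _ Hz)).
  assert (M1 := mu_minus_1_le z (Req_le _ _ Hz)).
  pose proof (bra_ge_1 w) as Hbr. pose proof (bra_ge_1 b) as Hbb.
  pose proof (bra_le w). pose proof (bra_le b).
  pose proof (Cmod_ge_0 w) as Hw.
  set (D := (RtoC (Cmod c) * z - c)%C).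
  assert (HD : Cmod D <= 4 * (1 + B) * Cmod w * Cmod c)
    by exact maximizer_near_direction.
  assert (Hi : 0 < / mu r w z <= 2).
  { split. apply Rinv_0_lt_compat; lra.
    replace 2 with (/ (1 / 2)) by lra. apply Rinv_le_contravar; lra. }
  set (m := mu r w z) in *.
  assert (E : 3 * Rdot w b + B * Cmod c
    = - (3 * (bra b - 1) * bra w) + / m * / bra w * Rdot w c
      + B * / m * ((m - 1) * Cmod c) + B * / m * Rdot z D).
  { assert (Ezc : Rdot z c = Cmod c - Rdot z D).
    { transitivity (Cmod c * Rdot z z - Rdot z D).
      - unfold D. Rdot_ring.
      - rewrite Rdot_self, Hz. ring. }
    replace (Rdot (w - RtoC (B * bra w) * z) c)
      with (Rdot w c - B * bra w * (Cmod c - Rdot z D)) in H0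
      by (rewrite <- Ezc; Rdot_ring).
    apply Rminus_diag_uniq. rewrite <- H0. field. lra. }
  rewrite E. clear E H0.
  assert (T1 : Rabs (3 * (bra b - 1) * bra w) <= 3 * Cmod b ^ 2).
  { rewrite Rabs_pos_eq by (apply Rmult_le_pos; lra).
    assert (bra w <= 2) by nra.
    assert ((bra b - 1) * bra w <= Cmod b ^ 2 / 2 * 2) by (apply Rmult_le_compat; lra).
    lra. }
  assert (T2 : Rabs (/ m * / bra w * Rdot w c) <= 2 * (Cmod w * Cmod c)).
  { assert (0 < / bra w <= 1).
    { split. apply Rinv_0_lt_compat; lra. rewrite <- Rinv_1. apply Rinv_le_contravar; lra. }
    rewrite Rabs_mult, Rabs_pos_eq by nra.
    apply Rmult_le_compat; auto using Rabs_pos, Rdot_le_Cmod; nra. }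
  assert (T3 : Rabs (B * / m * ((m - 1) * Cmod c)) <= 2 * B * ((1 + B) * Cmod w * Cmod c)).
  { rewrite Rabs_mult, Rabs_pos_eq by nra.
    apply Rmult_le_compat; auto using Rabs_pos; try nra.
    rewrite Rabs_mult, (Rabs_pos_eq (Cmod c)) by lra. nra. }
  assert (T4 : Rabs (B * / m * Rdot z D) <= 2 * B * (4 * (1 + B) * Cmod w * Cmod c)).
  { rewrite Rabs_mult, Rabs_pos_eq by nra.
    apply Rmult_le_compat; auto using Rabs_pos; try nra.
    eapply Rle_trans; [apply Rdot_le_Cmod|]. rewrite Hz. lra. }
  assert (0 <= Cmod w * Cmod c) by nra.
  assert (K1 : 0 <= (10 * (1 + B) ^ 2 - (2 + 10 * B * (1 + B))) * (Cmod w * Cmod c))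
    by (apply Rmult_le_pos; nra).
  assert (K2 : 0 <= (10 * (1 + B) ^ 2 - 3) * Cmod b ^ 2) by (apply Rmult_le_pos; nra).
  eapply Rle_trans; [eapply Rle_trans; [apply Rabs_triang|];
    apply Rplus_le_compat_r; eapply Rle_trans; [apply Rabs_triang|];
    apply Rplus_le_compat_r; apply Rabs_triang|].
  rewrite Rabs_Ropp. lra.
Qed.
End Pointwise.

(** * Curves in the complex plane *)

Lemma tends_to_RtoC (f : R -> R) (l : R) :
  filterlim f near0 (locally l) -> tends_to (fun t => RtoC (f t)) (RtoC l).
Proof.
  intros H. apply filterlim_locally. intros e.
  generalize (proj1 (filterlim_locally f l) H e). apply filter_imp.
  intros t Ht. split; [exact Ht|apply ball_center].
Qed.

Lemma tends_to_fst (f : R -> C) (l : C) :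
  tends_to f l -> filterlim (fun t => fst (f t)) near0 (locally (fst l)).
Proof.
  intros H. refine (filterlim_comp _ _ _ f fst _ _ _ H _).
  destruct l as [x y]. exact (continuous_fst (U := R_UniformSpace) (V := R_UniformSpace) x y).
Qed.

Lemma tends_to_snd (f : R -> C) (l : C) :
  tends_to f l -> filterlim (fun t => snd (f t)) near0 (locally (snd l)).
Proof.
  intros H. refine (filterlim_comp _ _ _ f snd _ _ _ H _).
  destruct l as [x y]. exact (continuous_snd (U := R_UniformSpace) (V := R_UniformSpace) x y).
Qed.

(** The limit of a real-valued function in the complex plane is real. *)
Lemma nonzero_limit_RtoC_iff (f : R -> R) (k : nat) :
  nonzero_limit (fun t => RtoC (f t)) k <-> exists l, l <> 0 /\ asym f k l.
Proof.
  assert (E : near0 (fun t => RtoC (f t / t ^ k) = (RtoC (f t) / RtoC (t ^ k))%C)).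
  { apply (near0_imp _ _ (near0_lt 1 Rlt_0_1)). intros t Ht _. apply RtoC_div.
    apply pow_nonzero. lra. }
  split.
  - intros [l [Hl H]].
    apply (filterlim_ext_loc _ (fun t => RtoC (f t / t ^ k))) in H.
    2:{ revert E. apply filter_imp. auto. }
    exists (fst l). split; [|exact (tends_to_fst _ _ H)].
    intros H0. apply Hl. apply injective_projections; [exact H0|].
    apply (filterlim_near0_unique (fun _ => 0)); [exact (tends_to_snd _ _ H)|].
    apply filterlim_const.
  - intros [l [Hl H]]. exists (RtoC l). split.
    + intros H0. apply Hl. exact (f_equal fst H0).
    + apply (filterlim_ext_loc _ _ E). apply tends_to_RtoC. exact H.
Qed.

Lemma has_val_of_asym (eps : R) (f : R -> R) (p : nat) (l : R) : l <> 0 ->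
  asym f p l -> has_val eps (fun t => RtoC (f t)) (Some p).
Proof.
  intros Hl H. split.
  - apply nonzero_limit_RtoC_iff. exists l. auto.
  - intros j Hj. apply nonzero_limit_RtoC_iff in Hj as [l' [Hl' H']].
    exact (bigO_order_le _ _ _ _ Hl' H' (bigO_of_asym _ _ _ H)).
Qed.

Lemma asym_Cmod_of_has_val (eps : R) (u : R -> C) (k : nat) :
  has_val eps (fun t => RtoC (Cmod (u t))) (Some k) ->
  exists l, 0 < l /\ asym (fun t => Cmod (u t)) k l.
Proof.
  intros [H _]. apply nonzero_limit_RtoC_iff in H as [l [Hl H]].
  exists l. split; [|exact H].
  destruct (Rle_lt_dec l 0) as [Hle|]; [|assumption]. exfalso.
  assert (He : 0 < - l) by lra.
  apply near0_const. apply (near0_imp _ _ (proj1 (filterlim_near0_iff _ _) H _ He)).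
  intros t Ht H1. apply Rabs_lt_between in H1.
  assert (0 < t ^ k) by (apply pow_lt; lra).
  assert (0 <= Cmod (u t) / t ^ k).
  { apply Rdiv_le_0_compat; [apply Cmod_ge_0|assumption]. }
  lra.
Qed.

Lemma derivative_is_fst (u : R -> C) (t : R) (l : C) :
  derivative_is u t l -> is_derive (fun s => fst (u s)) t (fst l).
Proof.
  intros H.
  exact (filterdiff_comp' u fst t _ _ H
    (filterdiff_linear (K := R_AbsRing)
       (U := prod_NormedModule R_AbsRing R_NormedModule R_NormedModule)
       (V := R_NormedModule) _ is_linear_fst)).
Qed.

Lemma derivative_is_snd (u : R -> C) (t : R) (l : C) :
  derivative_is u t l -> is_derive (fun s => snd (u s)) t (snd l).
Proof.
  intros H.
  exact (filterdiff_comp' u snd t _ _ H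
    (filterdiff_linear (K := R_AbsRing)
       (U := prod_NormedModule R_AbsRing R_NormedModule R_NormedModule)
       (V := R_NormedModule) _ is_linear_snd)).
Qed.

Lemma is_derive_mult_R (f g : R -> R) (t f' g' : R) :
  is_derive f t f' -> is_derive g t g' ->
  is_derive (fun s => f s * g s) t (f' * g t + f t * g').
Proof. intros Hf Hg. exact (is_derive_mult f g t f' g' Hf Hg Rmult_comm). Qed.

Lemma is_derive_Rdot (u v : R -> C) (t : R) (u' v' : C) :
  derivative_is u t u' -> derivative_is v t v' ->
  is_derive (fun s => Rdot (u s) (v s)) t (Rdot u' (v t) + Rdot (u t) v').
Proof.
  intros Hu Hv.
  apply (is_derive_ext (fun s => fst (u s) * fst (v s) + snd (u s) * snd (v s))).
  { intros s. symmetry. apply Rdot_coord. }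
  replace (Rdot u' (v t) + Rdot (u t) v') with
    ((fst u' * fst (v t) + fst (u t) * fst v') + (snd u' * snd (v t) + snd (u t) * snd v'))
    by Rdot_ring.
  apply (is_derive_plus (V := R_NormedModule)
           (fun s => fst (u s) * fst (v s)) (fun s => snd (u s) * snd (v s))).
  - apply is_derive_mult_R; apply derivative_is_fst; assumption.
  - apply is_derive_mult_R; apply derivative_is_snd; assumption.
Qed.

Lemma is_derive_Rdot_Ci (u v : R -> C) (t : R) (u' v' : C) :
  derivative_is u t u' -> derivative_is v t v' ->
  is_derive (fun s => Rdot (u s) (Ci * v s)%C) t
    (Rdot u' (Ci * v t)%C + Rdot (u t) (Ci * v')%C).
Proof.
  intros Hu Hv.
  apply (is_derive_ext (fun s => snd (u s) * fst (v s) - fst (u s) * snd (v s))).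
  { intros s. Rdot_ring. }
  replace (Rdot u' (Ci * v t)%C + Rdot (u t) (Ci * v')%C) with
    ((snd u' * fst (v t) + snd (u t) * fst v') - (fst u' * snd (v t) + fst (u t) * snd v'))
    by Rdot_ring.
  apply (is_derive_minus (V := R_NormedModule)
           (fun s => snd (u s) * fst (v s)) (fun s => fst (u s) * snd (v s)));
    apply is_derive_mult_R;
    first [apply derivative_is_fst; assumption | apply derivative_is_snd; assumption].
Qed.

Lemma is_derive_bra (u : R -> C) (t : R) (u' : C) :
  derivative_is u t u' ->
  is_derive (fun s => bra (u s)) t (Rdot (u t) u' / bra (u t)).
Proof.
  intros Hu.
  apply (is_derive_ext (fun s => sqrt (1 + Rdot (u s) (u s)))).
  { intros s. unfold bra. now rewrite Rdot_self. }
  assert (E : sqrt (1 + Rdot (u t) (u t)) = bra (u t)).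
  { unfold bra. now rewrite Rdot_self. }
  pose proof (bra_ge_1 (u t)).
  replace (Rdot (u t) u' / bra (u t)) with
    ((0 + (Rdot u' (u t) + Rdot (u t) u')) * / (2 * sqrt (1 + Rdot (u t) (u t)))).
  - apply (is_derive_comp sqrt (fun s => 1 + Rdot (u s) (u s))).
    + apply is_derive_Reals. apply derivable_pt_lim_sqrt. rewrite Rdot_self. nra.
    + apply (is_derive_plus (V := R_NormedModule) (fun _ => 1) (fun s => Rdot (u s) (u s))).
      * apply (is_derive_const (V := R_NormedModule)).
      * apply is_derive_Rdot; exact Hu.
  - rewrite E. replace (Rdot u' (u t)) with (Rdot (u t) u') by Rdot_ring. field. lra.
Qed.

Lemma Cmod_le_fst_snd (x : C) : Cmod x <= Rabs (fst x) + Rabs (snd x).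
Proof.
  pose proof (Cmod_ge_0 x). pose proof (Cmod2_alt x) as E. unfold Re, Im in E.
  pose proof (Rabs_pos (fst x)). pose proof (Rabs_pos (snd x)).
  rewrite <- (pow2_abs (fst x)), <- (pow2_abs (snd x)) in E.
  nra.
Qed.

Lemma Rabs_fst_le (x : C) : Rabs (fst x) <= Cmod x.
Proof. eapply Rle_trans; [apply Rmax_l|apply Rmax_Cmod]. Qed.

Lemma Rabs_snd_le (x : C) : Rabs (snd x) <= Cmod x.
Proof. eapply Rle_trans; [apply Rmax_r|apply Rmax_Cmod]. Qed.

Notation bigOC u := (bigO (fun t => Cmod (u t))).

Lemma bigOC_fst (u : R -> C) (p : nat) : bigOC u p -> bigO (fun t => fst (u t)) p.
Proof.
  apply (bigO_le _ _ _ 1); [lra|]. apply filter_forall. intros t.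
  rewrite (Rabs_pos_eq (Cmod _)) by apply Cmod_ge_0.
  pose proof (Rabs_fst_le (u t)). lra.
Qed.

Lemma bigOC_snd (u : R -> C) (p : nat) : bigOC u p -> bigO (fun t => snd (u t)) p.
Proof.
  apply (bigO_le _ _ _ 1); [lra|]. apply filter_forall. intros t.
  rewrite (Rabs_pos_eq (Cmod _)) by apply Cmod_ge_0.
  pose proof (Rabs_snd_le (u t)). lra.
Qed.

Lemma bigOC_of_fst_snd (u : R -> C) (p : nat) :
  bigO (fun t => fst (u t)) p -> bigO (fun t => snd (u t)) p -> bigOC u p.
Proof.
  intros [K [HK H1]] [L [HL H2]]. exists (K + L). split; [lra|].
  apply (near0_imp2 _ _ _ H1 H2). intros t _ Ht1 Ht2.
  rewrite Rabs_pos_eq by apply Cmod_ge_0.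
  pose proof (Cmod_le_fst_snd (u t)). lra.
Qed.

(** The norm of a vector may fail to be differentiable where it vanishes, so the
    integration is done on the coordinates. *)
Lemma bigOC_of_derivative (u u' : R -> C) (p : nat) :
  near0 (fun t => derivative_is u t (u' t)) ->
  bigOC u 1 -> bigOC u' p -> bigOC u (S p).
Proof.
  intros Hd Hu Hu'. apply bigOC_of_fst_snd.
  - apply (bigO_of_derive _ (fun t => fst (u' t))).
    + revert Hd. apply filter_imp. intros t. apply derivative_is_fst.
    + apply (bigO_filterlim _ 1); [lia|]. now apply bigOC_fst.
    + now apply bigOC_fst.
  - apply (bigO_of_derive _ (fun t => snd (u' t))).
    + revert Hd. apply filter_imp. intros t. apply derivative_is_snd.
    + apply (bigO_filterlim _ 1); [lia|]. now apply bigOC_snd.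
    + now apply bigOC_snd.
Qed.

Lemma bigO_Rdot (u v : R -> C) (p q : nat) :
  bigOC u p -> bigOC v q -> bigO (fun t => Rdot (u t) (v t)) (p + q).
Proof.
  intros Hu Hv. apply (bigO_le _ (fun t => Cmod (u t) * Cmod (v t)) _ 1); [lra| |].
  - apply filter_forall. intros t. rewrite Rmult_1_l.
    eapply Rle_trans; [apply Rdot_le_Cmod|apply Rle_abs].
  - now apply bigO_mult.
Qed.

Lemma bigOC_Ci (u : R -> C) (p : nat) : bigOC u p -> bigOC (fun t => Ci * u t)%C p.
Proof.
  apply bigO_ext. apply filter_forall. intros t. rewrite Cmod_mult, Cmod_Ci. ring.
Qed.

Lemma bigO_bra_minus_1 (u : R -> C) (p : nat) :
  bigOC u p -> bigO (fun t => bra (u t) - 1) (p + p).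
Proof.
  intros Hu. apply (bigO_le _ (fun t => Cmod (u t) * Cmod (u t)) _ 1); [lra| |].
  - apply filter_forall. intros t.
    pose proof (bra_ge_1 (u t)). pose proof (bra_le (u t)).
    rewrite !Rabs_pos_eq by nra. nra.
  - now apply bigO_mult.
Qed.

Lemma bigO_bra (u : R -> C) (p : nat) : bigOC u p -> bigO (fun t => bra (u t)) 0.
Proof.
  intros Hu. apply (bigO_ext (fun t => (bra (u t) - 1) + 1)).
  { apply filter_forall. intros; ring. }
  apply bigO_plus; [|apply bigO_const].
  apply (bigO_weaken _ (p + p)); [lia|]. now apply bigO_bra_minus_1.
Qed.

Lemma asym_bra (u : R -> C) (p : nat) : (1 <= p)%nat ->
  bigOC u p -> asym (fun t => bra (u t)) 0 1.
Proof.
  intros Hp Hu. apply (asym_perturb (fun _ => 1)); [apply asym_const|].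
  apply (bigO_weaken _ (p + p)); [lia|]. now apply bigO_bra_minus_1.
Qed.

(** [[p] - 1 = |p|^2 / ([p] + 1)]. *)
Lemma asym_bra_minus_1 (u : R -> C) (p : nat) (l : R) : (1 <= p)%nat ->
  asym (fun t => Cmod (u t)) p l ->
  asym (fun t => bra (u t) - 1) (p + p) (l ^ 2 / 2).
Proof.
  intros Hp Hu.
  apply (asym_ext (fun t => Cmod (u t) * Cmod (u t) / (bra (u t) + 1))).
  { apply filter_forall. intros t. pose proof (bra_ge_1 (u t)).
    pose proof (bra_sqr (u t)).
    replace (Cmod (u t) * Cmod (u t)) with ((bra (u t) - 1) * (bra (u t) + 1)) by lra.
    field. lra. }
  replace (l ^ 2 / 2) with (l * l / (1 + 1)) by field.
  apply asym_div with (q := 0%nat); [lra| |].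
  - rewrite Nat.add_0_r. now apply asym_mult.
  - apply asym_plus; [|apply asym_const]. apply asym_bra with p; [exact Hp|].
    now apply bigO_of_asym with l.
Qed.

Lemma bigOC_plus (u v : R -> C) (p : nat) :
  bigOC u p -> bigOC v p -> bigOC (fun t => u t + v t)%C p.
Proof.
  intros Hu Hv. apply (bigO_le _ (fun t => Cmod (u t) + Cmod (v t)) _ 1); [lra| |].
  - apply filter_forall. intros t. rewrite Rabs_pos_eq by apply Cmod_ge_0.
    pose proof (Cmod_triangle (u t) (v t)).
    pose proof (Rle_abs (Cmod (u t) + Cmod (v t))). lra.
  - now apply bigO_plus.
Qed.

Lemma bigOC_scal (f : R -> R) (v : R -> C) (p q : nat) :
  bigO f p -> bigOC v q -> bigOC (fun t => RtoC (f t) * v t)%C (p + q).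
Proof.
  intros Hf Hv. apply (bigO_le _ (fun t => f t * Cmod (v t)) _ 1); [lra| |].
  - apply filter_forall. intros t. rewrite Rabs_pos_eq by apply Cmod_ge_0.
    rewrite Cmod_mult, Cmod_R, Rabs_mult, (Rabs_pos_eq (Cmod _)) by apply Cmod_ge_0. lra.
  - now apply bigO_mult.
Qed.

(** * The perturbed Fuller system *)

(** The amounts by which [w'], [c'] and [|c| z] miss the right-hand sides of the
    Fuller system. The exact hyperbolic factors [[b] - 1] and [[w]] stay in the
    equation for [c']: in the derivative of the angular momentum the first
    multiplies [R(w,iw) = 0] and the second cancels against the one in [b']. *)
Definition w_err (B : R) (z w' : C) : C := (w' + Ci * (RtoC B * z))%C.
Definition c_err (w b c' : C) : C :=
  (c' + RtoC 3 * (Ci * (RtoC (bra b - 1) * w + RtoC (bra w) * b)))%C.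
Definition z_err (c z : C) : C := (RtoC (Cmod c) * z - c)%C.

Lemma Rdot_b_rhs_Ci (w b v : C) :
  Rdot (b_rhs w b) (Ci * v)%C = 2 * bra b * Rdot w v + 2 * bra w * Rdot b v.
Proof. unfold b_rhs. Rdot_ring. Qed.

Lemma Rdot_b_b_rhs (w b : C) :
  Rdot b (b_rhs w b) = 2 * bra b * Rdot b (Ci * w)%C.
Proof. unfold b_rhs. Rdot_ring. Qed.

Lemma Rdot_Ci_dw (B : R) (v z w' : C) :
  Rdot v (Ci * w')%C = B * Rdot v z + Rdot v (Ci * w_err B z w')%C.
Proof. unfold w_err. Rdot_ring. Qed.

Lemma Rdot_dw_c (B : R) (c z w' : C) :
  Rdot w' c = Rdot (w_err B z w') c + B * Rdot (Ci * z)%C (z_err c z).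
Proof. unfold w_err, z_err. Rdot_ring. Qed.

Lemma Rdot_z_c (c z : C) : Cmod z = 1 -> Rdot c z = Cmod c - Rdot z (z_err c z).
Proof.
  intros Hz. transitivity (Cmod c * Rdot z z - Rdot z (z_err c z)).
  - unfold z_err. Rdot_ring.
  - rewrite Rdot_self, Hz. ring.
Qed.

Lemma Rdot_dc (v w b c' : C) :
  Rdot v c' = Rdot v (c_err w b c')
    - 3 * (bra b - 1) * Rdot v (Ci * w)%C - 3 * bra w * Rdot v (Ci * b)%C.
Proof. unfold c_err. Rdot_ring. Qed.

Lemma Rdot_Ci_dc (v w b c' : C) :
  Rdot v (Ci * c')%C = Rdot v (Ci * c_err w b c')%C
    + 3 * (bra b - 1) * Rdot v w + 3 * bra w * Rdot v b.
Proof. unfold c_err. Rdot_ring. Qed.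

(** What the Pontryagin system says near [t = 0], with one constant [K] for all
    errors. [w'] and [c'] are values of the derivatives, no longer tied to the
    formulas that define them. *)
Record reduced_system (B K : R) (w b c z w' c' : R -> C) : Prop := {
  red_K : 0 <= K;
  red_z : near0 (fun t => Cmod (z t) = 1);
  red_dw : near0 (fun t => derivative_is w t (w' t));
  red_db : near0 (fun t => derivative_is b t (b_rhs (w t) (b t)));
  red_dc : near0 (fun t => derivative_is c t (c' t));
  red_w_err : near0 (fun t => Cmod (w_err B (z t) (w' t)) <= K * Cmod (w t));
  red_c_err : near0 (fun t => Cmod (c_err (w t) (b t) (c' t)) <= K * Cmod (c t));
  red_z_err : near0 (fun t => Cmod (z_err (c t) (z t)) <= K * Cmod (w t) * Cmod (c t));
  red_ham : near0 (fun t => Rabs (3 * Rdot (w t) (b t) + B * Cmod (c t))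
                      <= K * (Cmod (w t) * Cmod (c t) + Cmod (b t) ^ 2)) }.

Arguments red_K {_ _ _ _ _ _ _ _} _.
Arguments red_z {_ _ _ _ _ _ _ _} _.
Arguments red_dw {_ _ _ _ _ _ _ _} _.
Arguments red_db {_ _ _ _ _ _ _ _} _.
Arguments red_dc {_ _ _ _ _ _ _ _} _.
Arguments red_w_err {_ _ _ _ _ _ _ _} _.
Arguments red_c_err {_ _ _ _ _ _ _ _} _.
Arguments red_z_err {_ _ _ _ _ _ _ _} _.
Arguments red_ham {_ _ _ _ _ _ _ _} _.

(** Since [w] tends to [0] and [c] does not vanish near [0], the pointwise
    estimates apply; they all hold with the constant [10 (1 + B)^2]. *)
Lemma reduced_system_of_optimal (r eps : R) (w b c z : R -> C) (k n : nat) (w0 c0 : R) :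
  0 < eps -> 0 < beta1 r ->
  (forall t, 0 < t < eps ->
    star_condition r (w t) /\
    is_maximizer r (9 / 4) (w t) (b t) (c t) (z t) /\
    hamiltonian r (9 / 4) (w t) (b t) (c t) (z t) = 0 /\
    derivative_is b t (b_rhs (w t) (b t)) /\
    derivative_is w t (w_rhs r (w t) (z t)) /\
    derivative_is c t (c_rhs r (9 / 4) (w t) (b t) (c t) (z t))) ->
  0 < c0 -> (0 < k)%nat ->
  asym (fun t => Cmod (w t)) k w0 -> asym (fun t => Cmod (c t)) n c0 ->
  reduced_system (beta1 r) (10 * (1 + beta1 r) ^ 2) w b c z
    (fun t => w_rhs r (w t) (z t)) (fun t => c_rhs r (9 / 4) (w t) (b t) (c t) (z t)).
Proof.
  intros Heps HB H Hc0 Hk Aw Ac.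
  assert (Hsmall : near0 (fun t => 0 < t < eps /\ 0 < Cmod (c t) /\
            Cmod (w t) <= 1 /\ beta1 r * Cmod (w t) <= 1 / 2)).
  { assert (Hh : 0 < / (2 * (1 + beta1 r))) by (apply Rinv_0_lt_compat; lra).
    assert (Lw := bigO_filterlim _ _ Hk (bigO_of_asym _ _ _ Aw)).
    apply (near0_imp2 _ _ _ (near0_lt eps Heps)
      (filter_and _ _ (near0_pos_of_asym _ _ _ (fun t => Cmod_ge_0 (c t)) Hc0 Ac)
        (proj1 (filterlim_near0_iff _ _) Lw _ Hh))).
    intros t _ Ht [Hc Hw]. split; [exact Ht|]. split; [exact Hc|].
    rewrite Rminus_0_r, Rabs_pos_eq in Hw by apply Cmod_ge_0.
    assert (H2 : Cmod (w t) * (2 * (1 + beta1 r)) < 1).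
    { apply (Rmult_lt_compat_r (2 * (1 + beta1 r))) in Hw; [|lra].
      rewrite Rinv_l in Hw by lra. exact Hw. }
    pose proof (Cmod_ge_0 (w t)). nra. }
  split; [nra|..]; apply (near0_imp _ _ Hsmall); intros t _ [Ht [Hc [Hw1 HwB]]];
    destruct (H t Ht) as [_ [Hmax [Hham [Hdb [Hdw Hdc]]]]]; pose proof (proj1 Hmax) as Hz.
  - exact Hz.
  - exact Hdw.
  - exact Hdb.
  - exact Hdc.
  - now apply w_rhs_approx.
  - now apply c_rhs_approx.
  - eapply Rle_trans; [now apply (maximizer_near_direction r (w t) (b t))|].
    assert (0 <= (10 * (1 + beta1 r) ^ 2 - 4 * (1 + beta1 r)) * (Cmod (w t) * Cmod (c t))).
    { pose proof (Cmod_ge_0 (w t)). apply Rmult_le_pos; nra. }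
    lra.
  - now apply hamiltonian_zero_approx with (z := z t).
Qed.

(** * Exponents and leading coefficients *)

Section Reduced.
Variables (B K : R) (w b c z w' c' : R -> C).
Hypothesis HB : 0 < B.
Hypothesis Hsys : reduced_system B K w b c z w' c'.
Variables (k m n : nat) (w0 b0 c0 : R).
Hypothesis Hw0 : 0 < w0.
Hypothesis Hb0 : 0 < b0.
Hypothesis Hc0 : 0 < c0.
Hypothesis Hw : asym (fun t => Cmod (w t)) k w0.
Hypothesis Hb : asym (fun t => Cmod (b t)) m b0.
Hypothesis Hc : asym (fun t => Cmod (c t)) n c0.
Hypothesis Hk : (1 <= k)%nat.
Hypothesis Hm : (1 <= m)%nat.
Hypothesis Hn : (1 <= n)%nat.

Let F t := w_err B (z t) (w' t).
Let E t := c_err (w t) (b t) (c' t).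
Let D t := z_err (c t) (z t).

Lemma bigOC_w : bigOC w k.
Proof. exact (bigO_of_asym _ _ _ Hw). Qed.
Lemma bigOC_b : bigOC b m.
Proof. exact (bigO_of_asym _ _ _ Hb). Qed.
Lemma bigOC_c : bigOC c n.
Proof. exact (bigO_of_asym _ _ _ Hc). Qed.

Lemma bigOC_le (u : R -> C) (g : R -> R) (p : nat) :
  near0 (fun t => Cmod (u t) <= K * g t) -> bigO g p -> bigOC u p.
Proof.
  pose proof (red_K Hsys) as HK.
  intros H. apply (bigO_le _ _ _ K); [exact HK|].
  revert H. apply filter_imp. intros t H.
  rewrite Rabs_pos_eq by apply Cmod_ge_0. pose proof (Rle_abs (g t)). nra.
Qed.

Lemma bigOC_F : bigOC F k.
Proof. apply (bigOC_le _ _ _ (red_w_err Hsys) bigOC_w). Qed.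

Lemma bigOC_E : bigOC E n.
Proof. apply (bigOC_le _ _ _ (red_c_err Hsys) bigOC_c). Qed.

Lemma bigOC_D : bigOC D (k + n).
Proof.
  apply (bigOC_le _ (fun t => Cmod (w t) * Cmod (c t))).
  - generalize (red_z_err Hsys). apply filter_imp. intros t H.
    now rewrite <- Rmult_assoc.
  - apply bigO_mult; [apply bigOC_w|apply bigOC_c].
Qed.

Lemma bigOC_z : bigOC z 0.
Proof.
  apply (bigO_ext (fun _ => 1)); [|apply bigO_const].
  generalize (red_z Hsys). apply filter_imp. auto.
Qed.

Lemma bigO_bra_w : bigO (fun t => bra (w t)) 0.
Proof. exact (bigO_bra _ _ bigOC_w). Qed.
Lemma bigO_bra_b : bigO (fun t => bra (b t)) 0.
Proof. exact (bigO_bra _ _ bigOC_b). Qed.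
Lemma bigO_bra_w_minus_1 : bigO (fun t => bra (w t) - 1) (k + k).
Proof. exact (bigO_bra_minus_1 _ _ bigOC_w). Qed.
Lemma bigO_bra_b_minus_1 : bigO (fun t => bra (b t) - 1) (m + m).
Proof. exact (bigO_bra_minus_1 _ _ bigOC_b). Qed.

(** [monom] computes the order of a product of known factors, [order] that of a
    combination of such products against a given exponent, and [order_of e] first
    rewrites the function as [e]. *)
Ltac monom :=
  first
    [ exact bigOC_w | exact bigOC_b | exact bigOC_c | exact bigOC_F | exact bigOC_E
    | exact bigOC_D | exact bigOC_z
    | exact bigO_bra_w | exact bigO_bra_b | exact bigO_bra_w_minus_1 | exact bigO_bra_b_minus_1
    | apply bigOC_Ci; monom
    | apply bigO_Rdot; [monom|monom]
    | apply bigO_const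
    | apply bigO_mult; [monom|monom] ].
Ltac weak_monom := eapply bigO_weaken; [|monom]; lia.
Ltac order :=
  lazymatch goal with
  | |- bigO (fun t => @?f t + @?g t) _ => apply bigO_plus; order
  | |- bigO (fun t => @?f t - @?g t) _ => apply bigO_minus; order
  | |- bigO (fun t => - @?f t) _ => apply bigO_opp; order
  | |- _ => first [weak_monom | apply bigO_scal; order]
  end.
Ltac order_of e := apply (bigO_ext e); [|order].

Lemma bigOC_b_rhs (p : nat) :
  (p <= k)%nat -> (p <= m)%nat -> bigOC (fun t => b_rhs (w t) (b t)) p.
Proof.
  intros Hp1 Hp2.
  apply (bigO_ext (fun t =>
    Cmod (Ci * (RtoC (2 * bra (b t)) * w t + RtoC (2 * bra (w t)) * b t))%C)).
  { apply filter_forall. intros t. f_equal. unfold b_rhs.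
    apply injective_projections; simpl; ring. }
  apply bigOC_Ci, bigOC_plus.
  - apply (bigO_weaken _ (0 + 0 + k)); [lia|]. apply bigOC_scal; monom.
  - apply (bigO_weaken _ (0 + 0 + m)); [lia|]. apply bigOC_scal; monom.
Qed.

Lemma bigOC_dc (p : nat) : (p <= m)%nat -> (p <= n)%nat -> bigOC c' p.
Proof.
  intros Hp1 Hp2.
  apply (bigO_ext (fun t => Cmod (E t + (RtoC (-3 * (bra (b t) - 1)) * (Ci * w t)
     + RtoC (-3 * bra (w t)) * (Ci * b t)))%C)).
  { apply filter_forall. intros t. f_equal. unfold E, c_err.
    apply injective_projections; simpl; ring. }
  apply bigOC_plus; [weak_monom|]. apply bigOC_plus.
  - apply (bigO_weaken _ (0 + (m + m) + k)); [lia|]. apply bigOC_scal; monom.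
  - apply (bigO_weaken _ (0 + 0 + m)); [lia|]. apply bigOC_scal; monom.
Qed.

Lemma two_le_m : (2 <= m)%nat.
Proof.
  apply (bigO_order_le _ _ _ _ (Rgt_not_eq _ _ Hb0) Hb).
  apply (bigOC_of_derivative _ _ 1 (red_db Hsys)).
  - weak_monom.
  - now apply bigOC_b_rhs.
Qed.

(** If [p <= m] and [p <= n], then [c' = O(|b| + |c|)] gives [p + 1 <= n]; this
    is used for [p = 1] and [p = 2]. *)
Lemma three_le_n : (3 <= n)%nat.
Proof.
  pose proof two_le_m as Hm2.
  assert (Hstep : forall p, (p <= m)%nat -> (p <= n)%nat -> (S p <= n)%nat).
  { intros p H1 H2. apply (bigO_order_le _ _ _ _ (Rgt_not_eq _ _ Hc0) Hc).
    apply (bigOC_of_derivative _ _ p (red_dc Hsys)).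
    - weak_monom.
    - now apply bigOC_dc. }
  auto.
Qed.

Let G t := 3 * ((bra (b t) - 1) * bra (w t)) - 2 * Rdot (w t) (c t).

(** [G] is [[w]] times the deviation [A - 3] of the angular momentum from its
    limit value. In [G'] the terms [6 [w] R(b,iw)] coming from [b'] and from [c']
    cancel, and so does the main part [R(-iBz, c)] of [R(w',c)], as [z] is nearly
    parallel to [c]. What remains is [O(|w| |c|) + O(|b|^2 |w|)]. *)
Lemma bigO_angular_defect (p : nat) :
  (p <= k + n)%nat -> (p <= k + (m + m))%nat -> bigO G (S p).
Proof.
  intros Hp1 Hp2.
  apply (bigO_of_derive _ (fun t =>
    3 * ((bra (b t) - 1) * (Rdot (w t) (w' t) / bra (w t)))
    - 2 * ((Rdot (F t) (c t) + B * Rdot (Ci * z t)%C (D t)) + Rdot (w t) (E t)))).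
  - apply (near0_imp2 _ _ _ (red_dw Hsys)
      (filter_and _ _ (red_db Hsys) (red_dc Hsys))).
    intros t _ Hdw [Hdb Hdc].
    pose proof (bra_ge_1 (w t)). pose proof (bra_ge_1 (b t)).
    replace (3 * ((bra (b t) - 1) * (Rdot (w t) (w' t) / bra (w t)))
      - 2 * ((Rdot (F t) (c t) + B * Rdot (Ci * z t)%C (D t)) + Rdot (w t) (E t)))
    with (3 * ((Rdot (b t) (b_rhs (w t) (b t)) / bra (b t) - 0) * bra (w t)
               + (bra (b t) - 1) * (Rdot (w t) (w' t) / bra (w t)))
          - 2 * (Rdot (w' t) (c t) + Rdot (w t) (c' t))).
    + apply (is_derive_minus (V := R_NormedModule)
        (fun s => 3 * ((bra (b s) - 1) * bra (w s))) (fun s => 2 * Rdot (w s) (c s))).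
      * apply (is_derive_scal (fun s => (bra (b s) - 1) * bra (w s))).
        apply (is_derive_mult_R (fun s => bra (b s) - 1)).
        -- apply (is_derive_minus (V := R_NormedModule) (fun s => bra (b s)) (fun _ => 1)).
           ++ now apply is_derive_bra.
           ++ apply (is_derive_const (V := R_NormedModule)).
        -- now apply is_derive_bra.
      * apply (is_derive_scal (fun s => Rdot (w s) (c s))). now apply is_derive_Rdot.
    + rewrite Rdot_b_b_rhs, (Rdot_dw_c B (c t) (z t) (w' t)),
        (Rdot_dc (w t) (w t) (b t) (c' t)), (Rdot_Ci_antisym (b t) (w t)).
      replace (Rdot (w t) (Ci * w t)%C) with 0 by Rdot_ring.
      unfold F, E, D. field. lra.
  - apply (bigO_filterlim _ 1); [lia|]. unfold G. pose proof two_le_m. order.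
  - apply bigO_minus; [|order].
    apply (bigO_weaken _ (0 + ((m + m) + (k + 0)))); [lia|].
    apply bigO_mult; [apply bigO_const|]. apply bigO_mult; [monom|].
    apply (bigO_le _ (fun t => Rdot (w t) (F t + RtoC (- B) * (Ci * z t))%C) _ 1); [lra| |].
    + apply filter_forall. intros t. pose proof (bra_ge_1 (w t)).
      replace (F t + RtoC (- B) * (Ci * z t))%C with (w' t)
        by (unfold F, w_err; apply injective_projections; simpl; ring).
      unfold Rdiv. rewrite Rabs_mult, Rmult_comm.
      apply Rmult_le_compat_r; [apply Rabs_pos|].
      rewrite Rabs_inv, Rabs_pos_eq by lra.
      rewrite <- Rinv_1. apply Rinv_le_contravar; lra.
    + apply bigO_Rdot; [monom|]. apply bigOC_plus; [weak_monom|].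
      apply (bigO_weaken _ (0 + 0)); [lia|].
      apply (bigOC_scal (fun _ => - B)); monom.
Qed.

Lemma asym_angular :
  asym (fun t => 3 * ((bra (b t) - 1) * bra (w t))) (m + m) (3 * (b0 ^ 2 / 2)).
Proof.
  apply asym_scal. rewrite <- (Nat.add_0_r (m + m)), <- (Rmult_1_r (b0 ^ 2 / 2)).
  apply asym_mult; [now apply asym_bra_minus_1|].
  apply (asym_bra w k Hk bigOC_w).
Qed.

(** If [2m < k + n], the term [3 ([b] - 1) [w]] of order [2m] would dominate in
    [G], which is of order at least [2m + 1]. *)
Lemma k_plus_n_le_2m : (k + n <= m + m)%nat.
Proof.
  destruct (Nat.le_gt_cases (k + n) (m + m)) as [H|H]; [exact H|exfalso].
  assert (HG : asym G (m + m) (3 * (b0 ^ 2 / 2))).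
  { apply (asym_perturb _ _ _ _ asym_angular).
    order_of (fun t => - 2 * Rdot (w t) (c t)).
    apply filter_forall. intros t. unfold G. ring. }
  assert (Hnz : 3 * (b0 ^ 2 / 2) <> 0) by nra.
  pose proof (bigO_order_le _ _ _ _ Hnz HG
    (bigO_angular_defect (m + m) ltac:(lia) ltac:(lia))).
  lia.
Qed.

(** The vanishing of the Hamiltonian; [|b|^2] is negligible against [|c|] since
    [n + 1 <= k + n <= 2m]. *)
Lemma asym_Rdot_b_w : asym (fun t => Rdot (b t) (w t)) n (- (B / 3) * c0).
Proof.
  apply (asym_perturb (fun t => - (B / 3) * Cmod (c t))).
  { now apply asym_scal. }
  pose proof k_plus_n_le_2m.
  apply (bigO_ext (fun t => (1 / 3) * (3 * Rdot (w t) (b t) + B * Cmod (c t)))).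
  { apply filter_forall. intros t. rewrite (Rdot_sym (b t)). field. }
  apply bigO_scal.
  apply (bigO_le _ (fun t => Cmod (w t) * Cmod (c t) + Cmod (b t) * Cmod (b t)) _ K).
  - apply (red_K Hsys).
  - generalize (red_ham Hsys). apply filter_imp. intros t H1.
    pose proof (red_K Hsys).
    pose proof (Rle_abs (Cmod (w t) * Cmod (c t) + Cmod (b t) * Cmod (b t))).
    replace (Cmod (b t) ^ 2) with (Cmod (b t) * Cmod (b t)) in H1 by ring. nra.
  - order.
Qed.

(** The two main parts of the derivative, [- 3 R(b,w)] from [c'] and [B |c|] from
    [w'], are equal by the Hamiltonian, so they add up to [2 B |c|]. *)
Lemma asym_Rdot_c_Ciw :
  asym (fun t => Rdot (c t) (Ci * w t)%C) (S n) (2 * B * c0 / INR (S n)).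
Proof.
  pose proof k_plus_n_le_2m.
  apply (asym_of_derive _ (fun t =>
      Rdot (c' t) (Ci * w t)%C + Rdot (c t) (Ci * w' t)%C)).
  - apply (near0_imp2 _ _ _ (red_dw Hsys) (red_dc Hsys)).
    intros t _ Hdw Hdc. now apply is_derive_Rdot_Ci.
  - apply (bigO_filterlim _ 1); [lia|]. order.
  - apply (asym_perturb (fun t => - 3 * (bra (w t) * Rdot (b t) (w t)) + B * Cmod (c t))).
    + replace (2 * B * c0) with (- 3 * (1 * (- (B / 3) * c0)) + B * c0) by field.
      apply asym_plus; apply asym_scal; [|exact Hc].
      apply (asym_mult _ _ 0 n); [exact (asym_bra w k Hk bigOC_w)|exact asym_Rdot_b_w].
    + order_of (fun t => - Rdot (w t) (Ci * E t)%C
         - 3 * ((bra (b t) - 1) * Rdot (w t) (w t))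
         - B * Rdot (z t) (D t) + Rdot (c t) (Ci * F t)%C).
      generalize (red_z Hsys). apply filter_imp. intros t Hz.
      rewrite (Rdot_Ci_dw B (c t) (z t) (w' t)), (Rdot_z_c _ _ Hz),
        (Rdot_Ci_antisym (c' t) (w t)), (Rdot_Ci_dc (w t) (w t) (b t) (c' t)),
        (Rdot_sym (b t) (w t)).
      unfold D, E, F. ring.
Qed.

(** [R(c,iw)] has order exactly [n + 1], and is at most [|c| |w|]. *)
Lemma k_eq_1 : k = 1%nat.
Proof.
  assert (H1 : 1 <= INR (S n)) by (rewrite S_INR; pose proof (pos_INR n); lra).
  assert (Hnz : 2 * B * c0 / INR (S n) <> 0).
  { apply Rgt_not_eq, Rdiv_lt_0_compat; nra. }
  pose proof (bigO_order_le _ _ _ _ Hnz asym_Rdot_c_Ciw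
                (bigO_Rdot _ _ _ _ bigOC_c (bigOC_Ci _ _ bigOC_w))).
  lia.
Qed.

(** If [m >= 3], then [2 |w|^2] is the main part of the derivative of [R(b,iw)],
    which would therefore have order 3, less than the order [m + 1] of
    [|b| |w|]. *)
Lemma m_eq_2 : m = 2%nat.
Proof.
  pose proof two_le_m. pose proof k_eq_1 as Hk1.
  destruct (Nat.le_gt_cases m 2) as [H2|H2]; [lia|exfalso].
  assert (HA : asym (fun t => Rdot (b t) (Ci * w t)%C) 3 (2 * (w0 * w0) / INR 3)).
  { apply (asym_of_derive _ (fun t =>
      Rdot (b_rhs (w t) (b t)) (Ci * w t)%C + Rdot (b t) (Ci * w' t)%C)).
    - apply (near0_imp2 _ _ _ (red_dw Hsys) (red_db Hsys)).
      intros t _ Hdw Hdb. now apply is_derive_Rdot_Ci.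
    - apply (bigO_filterlim _ 1); [lia|]. order.
    - apply (asym_perturb (fun t => 2 * (Cmod (w t) * Cmod (w t)))).
      { apply asym_scal. rewrite Hk1 in Hw. exact (asym_mult _ _ 1 1 _ _ Hw Hw). }
      order_of (fun t => 2 * ((bra (b t) - 1) * Rdot (w t) (w t))
         + 2 * (bra (w t) * Rdot (b t) (w t)) + B * Rdot (b t) (z t)
         + Rdot (b t) (Ci * F t)%C).
      apply filter_forall. intros t.
      rewrite Rdot_b_rhs_Ci, (Rdot_Ci_dw B (b t) (z t) (w' t)), Rdot_self. unfold F. ring. }
  assert (Hnz : 2 * (w0 * w0) / INR 3 <> 0).
  { apply Rgt_not_eq, Rdiv_lt_0_compat; [nra|simpl; lra]. }
  pose proof (bigO_order_le _ _ _ _ Hnz HA (bigO_Rdot _ _ _ _ bigOC_b (bigOC_Ci _ _ bigOC_w))).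
  lia.
Qed.

Lemma n_eq_3 : n = 3%nat.
Proof.
  pose proof three_le_n. pose proof k_plus_n_le_2m. pose proof k_eq_1. pose proof m_eq_2. lia.
Qed.

(** For these exponents [G = O(t^5)]. *)
Lemma asym_Rdot_c_w : asym (fun t => Rdot (c t) (w t)) 4 (3 / 4 * b0 ^ 2).
Proof.
  pose proof k_eq_1 as Hk1. pose proof m_eq_2 as Hm2. pose proof n_eq_3 as Hn3.
  replace (3 / 4 * b0 ^ 2) with (/ 2 * (3 * (b0 ^ 2 / 2))) by field.
  pose proof asym_angular as HA. rewrite Hm2 in HA.
  apply (asym_perturb _ _ _ _ (asym_scal _ _ (/ 2) _ HA)).
  apply (bigO_ext (fun t => - / 2 * G t)).
  { apply filter_forall. intros t. unfold G. rewrite (Rdot_sym (c t)). field. }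
  apply bigO_scal. apply bigO_angular_defect; lia.
Qed.

(** In the derivative, [b'] contributes [2 R(c,w) ~ 3/2 |b|^2] and [c']
    contributes [3 |b|^2]; the sum [9/2 |b|^2] is integrated over [t^4]. *)
Lemma asym_Rdot_b_Cic : asym (fun t => Rdot (b t) (Ci * c t)%C) 5 (9 / 10 * b0 ^ 2).
Proof.
  pose proof k_eq_1 as Hk1. pose proof m_eq_2 as Hm2. pose proof n_eq_3 as Hn3.
  replace (9 / 10 * b0 ^ 2) with ((2 * (3 / 4 * b0 ^ 2) + 3 * (b0 * b0)) / INR 5)
    by (simpl; field).
  apply (asym_of_derive _ (fun t =>
      Rdot (b_rhs (w t) (b t)) (Ci * c t)%C + Rdot (b t) (Ci * c' t)%C)).
  - apply (near0_imp2 _ _ _ (red_dc Hsys) (red_db Hsys)).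
    intros t _ Hdc Hdb. now apply is_derive_Rdot_Ci.
  - apply (bigO_filterlim _ 1); [lia|]. order.
  - apply (asym_perturb (fun t => 2 * Rdot (c t) (w t) + 3 * (Cmod (b t) * Cmod (b t)))).
    { apply asym_plus; apply asym_scal; [exact asym_Rdot_c_w|].
      rewrite Hm2 in Hb. exact (asym_mult _ _ 2 2 _ _ Hb Hb). }
    order_of (fun t => 2 * ((bra (b t) - 1) * Rdot (c t) (w t))
       + 2 * (bra (w t) * Rdot (b t) (c t)) + Rdot (b t) (Ci * E t)%C
       + 3 * ((bra (b t) - 1) * Rdot (b t) (w t))
       + 3 * ((bra (w t) - 1) * Rdot (b t) (b t))).
    apply filter_forall. intros t.
    rewrite Rdot_b_rhs_Ci, (Rdot_Ci_dc (b t) (w t) (b t) (c' t)),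
      (Rdot_sym (w t) (c t)), Rdot_self.
    unfold E. ring.
Qed.

(** [(|c|^2)' ~ 6 R(b,ic)], whose leading term is known. This relation is what
    makes the limit of [R(b,c) / t^5] nonzero. *)
Lemma c0_sqr : c0 ^ 2 = 9 / 10 * b0 ^ 2.
Proof.
  pose proof k_eq_1 as Hk1. pose proof m_eq_2 as Hm2. pose proof n_eq_3 as Hn3.
  assert (H1 : asym (fun t => Rdot (c t) (c t)) 6 (6 * (9 / 10 * b0 ^ 2) / INR 6)).
  { apply (asym_of_derive _ (fun t => Rdot (c' t) (c t) + Rdot (c t) (c' t))).
    - generalize (red_dc Hsys). apply filter_imp.
      intros t Hdc. now apply is_derive_Rdot.
    - apply (bigO_filterlim _ 1); [lia|]. order.
    - apply (asym_perturb _ _ _ _ (asym_scal _ _ 6 _ asym_Rdot_b_Cic)).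
      order_of (fun t => 2 * Rdot (c t) (E t)
         - 6 * ((bra (b t) - 1) * Rdot (c t) (Ci * w t)%C)
         + 6 * ((bra (w t) - 1) * Rdot (b t) (Ci * c t)%C)).
      apply filter_forall. intros t.
      rewrite (Rdot_sym (c' t) (c t)), (Rdot_dc (c t) (w t) (b t) (c' t)),
        (Rdot_Ci_antisym (c t) (b t)).
      unfold E. ring. }
  assert (H2 : asym (fun t => Rdot (c t) (c t)) 6 (c0 * c0)).
  { apply (asym_ext (fun t => Cmod (c t) * Cmod (c t))).
    - apply filter_forall. intros t. rewrite Rdot_self. ring.
    - rewrite Hn3 in Hc. exact (asym_mult _ _ 3 3 _ _ Hc Hc). }
  pose proof (asym_unique _ _ _ _ H1 H2) as H3. simpl in H3. lra.
Qed.

Lemma asym_Rdot_c_Ciw_4 : asym (fun t => Rdot (c t) (Ci * w t)%C) 4 (B / 2 * c0).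
Proof.
  pose proof asym_Rdot_c_Ciw as H. rewrite n_eq_3 in H.
  replace (B / 2 * c0) with (2 * B * c0 / INR 4) by (simpl; field). exact H.
Qed.

(** The real part of [(conj b c) (conj c w) = |c|^2 conj b w] is
    [R(b,c) R(c,w) - R(b,ic) R(c,iw) = |c|^2 R(b,w)], solved here for [R(b,c)]. *)
Lemma asym_Rdot_b_c : asym (fun t => Rdot (b t) (c t)) 5 (B / 5 * c0).
Proof.
  pose proof n_eq_3 as Hn3.
  pose proof asym_Rdot_b_w as Hbw. pose proof Hc as Hc3. rewrite Hn3 in Hbw, Hc3.
  pose proof c0_sqr as Hcb.
  assert (Hb2 : 0 < b0 ^ 2) by (apply pow_lt; lra).
  replace (B / 5 * c0) with
    ((c0 * c0 * (- (B / 3) * c0) + 9 / 10 * b0 ^ 2 * (B / 2 * c0)) / (3 / 4 * b0 ^ 2)).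
  2:{ replace (c0 * c0) with (9 / 10 * b0 ^ 2) by (rewrite <- Hcb; ring). field. lra. }
  apply (asym_ext (fun t =>
    (Cmod (c t) * Cmod (c t) * Rdot (b t) (w t)
     + Rdot (b t) (Ci * c t)%C * Rdot (c t) (Ci * w t)%C) / Rdot (c t) (w t))).
  { assert (Hpos : 0 < 3 / 4 * b0 ^ 2) by lra.
    apply (near0_imp _ _ (proj1 (filterlim_near0_iff _ _) asym_Rdot_c_w _ Hpos)).
    intros t Ht H.
    assert (H0 : Rdot (c t) (w t) <> 0).
    { intros H0. rewrite H0 in H. unfold Rdiv in H.
      rewrite Rmult_0_l, Rminus_0_l, Rabs_Ropp, Rabs_pos_eq in H; lra. }
    replace (Cmod (c t) * Cmod (c t)) with (Rdot (c t) (c t)) by (rewrite Rdot_self; ring).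
    apply (Rmult_eq_reg_r (Rdot (c t) (w t))); [|exact H0].
    unfold Rdiv. rewrite Rmult_assoc, Rinv_l, Rmult_1_r by exact H0. Rdot_ring. }
  apply asym_div with (q := 4%nat); [lra| |exact asym_Rdot_c_w].
  apply asym_plus.
  - exact (asym_mult _ _ 6 3 _ _ (asym_mult _ _ 3 3 _ _ Hc3 Hc3) Hbw).
  - exact (asym_mult _ _ 5 4 _ _ asym_Rdot_b_Cic asym_Rdot_c_Ciw_4).
Qed.

(** The imaginary part of the same identity, up to sign:
    [R(b,ic) R(c,w) + R(b,c) R(c,iw) = |c|^2 R(b,iw)]; both products on the left
    are positive. *)
Lemma asym_Rdot_b_Ciw : exists l, 0 < l /\ asym (fun t => Rdot (b t) (Ci * w t)%C) 3 l.
Proof.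
  pose proof n_eq_3 as Hn3. pose proof Hc as Hc3. rewrite Hn3 in Hc3.
  assert (Hb2 : 0 < b0 ^ 2) by (apply pow_lt; lra).
  exists ((9 / 10 * b0 ^ 2 * (3 / 4 * b0 ^ 2) + B / 5 * c0 * (B / 2 * c0)) / (c0 * c0)).
  split.
  { apply Rdiv_lt_0_compat; [|nra]. apply Rplus_lt_le_0_compat.
    - apply Rmult_lt_0_compat; lra.
    - apply Rmult_le_pos; apply Rmult_le_pos; lra. }
  apply (asym_ext (fun t =>
    (Rdot (b t) (Ci * c t)%C * Rdot (c t) (w t)
     + Rdot (b t) (c t) * Rdot (c t) (Ci * w t)%C) / (Cmod (c t) * Cmod (c t)))).
  { apply (near0_imp _ _ (near0_pos_of_asym _ _ _ (fun t => Cmod_ge_0 (c t)) Hc0 Hc)).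
    intros t _ H.
    assert (H0 : Cmod (c t) * Cmod (c t) <> 0) by nra.
    apply (Rmult_eq_reg_r (Cmod (c t) * Cmod (c t))); [|exact H0].
    unfold Rdiv. rewrite Rmult_assoc, Rinv_l, Rmult_1_r by exact H0.
    replace (Cmod (c t) * Cmod (c t)) with (Rdot (c t) (c t)) by (rewrite Rdot_self; ring).
    Rdot_ring. }
  apply asym_div with (q := 6%nat); [nra| |exact (asym_mult _ _ 3 3 _ _ Hc3 Hc3)].
  apply asym_plus.
  - exact (asym_mult _ _ 5 4 _ _ asym_Rdot_b_Cic asym_Rdot_c_w).
  - exact (asym_mult _ _ 5 4 _ _ asym_Rdot_b_c asym_Rdot_c_Ciw_4).
Qed.

Lemma reduced_system_leading_terms :
  (k = 1%nat /\ m = 2%nat /\ n = 3%nat) /\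
  asym (fun t => Rdot (b t) (w t)) 3 (- (B / 3) * c0) /\
  asym (fun t => Rdot (c t) (w t)) 4 (3 / 4 * b0 ^ 2) /\
  asym (fun t => Rdot (b t) (c t)) 5 (B / 5 * c0) /\
  (exists l, 0 < l /\ asym (fun t => Rdot (b t) (Ci * w t)%C) 3 l) /\
  asym (fun t => Rdot (c t) (Ci * w t)%C) 4 (B / 2 * c0) /\
  asym (fun t => Rdot (b t) (Ci * c t)%C) 5 (9 / 10 * b0 ^ 2).
Proof.
  pose proof asym_Rdot_b_w as Hbw. rewrite n_eq_3 in Hbw.
  split; [exact (conj k_eq_1 (conj m_eq_2 n_eq_3))|].
  exact (conj Hbw (conj asym_Rdot_c_w (conj asym_Rdot_b_c (conj asym_Rdot_b_Ciw
          (conj asym_Rdot_c_Ciw_4 asym_Rdot_b_Cic))))).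
Qed.
End Reduced.

(** * Valuations along optimal trajectories *)

Theorem theorem2p6p8 (r d eps : R) (w b c : R -> C)
  (heps : 0 < eps)
  (hopt : optimal_trajectory r d eps w b c)
  (hlim : tends_to_singular_locus d w b c)
  (hw : has_finite_nonzero_val eps (fun t => RtoC (Cmod (w t))))
  (hb : has_finite_nonzero_val eps (fun t => RtoC (Cmod (b t))))
  (hc : has_finite_nonzero_val eps (fun t => RtoC (Cmod (c t))))
  (hbeta : beta r / alpha <> 0) :
  (has_val eps (fun t => RtoC (Cmod (w t))) (Some 1%nat) /\
   has_val eps (fun t => RtoC (Cmod (b t))) (Some 2%nat) /\
   has_val eps (fun t => RtoC (Cmod (c t))) (Some 3%nat)) /\
  (has_val eps (fun t => RtoC (Rdot (b t) (w t))) (Some 3%nat) /\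
   has_val eps (fun t => RtoC (Rdot (c t) (w t))) (Some 4%nat) /\
   has_val eps (fun t => RtoC (Rdot (b t) (c t))) (Some 5%nat)) /\
  (has_val eps (fun t => RtoC (Rdot (b t) (Ci * w t)%C)) (Some 3%nat) /\
   has_val eps (fun t => RtoC (Rdot (c t) (Ci * w t)%C)) (Some 4%nat) /\
   has_val eps (fun t => RtoC (Rdot (b t) (Ci * c t)%C)) (Some 5%nat)).
Proof.
  destruct hopt as [_ [z Hz]]. destruct hlim as [-> _].
  destruct hw as [k [Hk Vw]], hb as [m [Hm Vb]], hc as [n [Hn Vc]].
  apply asym_Cmod_of_has_val in Vw as [w0 [Hw0 Aw]].
  apply asym_Cmod_of_has_val in Vb as [b0 [Hb0 Ab]].
  apply asym_Cmod_of_has_val in Vc as [c0 [Hc0 Ac]].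
  assert (HB : 0 < beta1 r).
  { assert (0 <= beta1 r).
    { unfold beta1, beta, alpha. pose proof (sqrt_pos ((3 * r ^ 2 - 1) / 2)). lra. }
    unfold beta1 in *. lra. }
  assert (Hsys := reduced_system_of_optimal r eps w b c z k n w0 c0
                    heps HB Hz Hc0 ltac:(lia) Aw Ac).
  destruct (reduced_system_leading_terms _ _ _ _ _ _ _ _ HB Hsys k m n w0 b0 c0
      Hw0 Hb0 Hc0 Aw Ab Ac ltac:(lia) ltac:(lia) ltac:(lia))
    as [[-> [-> ->]] [Abw [Acw [Abc [[l [Hl Abiw]] [Aciw Abic]]]]]].
  assert (0 < b0 ^ 2) by (apply pow_lt; lra).
  assert (0 < beta1 r * c0) by nra.
  refine (conj (conj _ (conj _ _)) (conj (conj _ (conj _ _)) (conj _ (conj _ _))));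
    (eapply has_val_of_asym; [|eassumption]);
    first [apply Rgt_not_eq; lra | apply Rlt_not_eq; lra].
Qed.
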